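(* Suppose that $X=Y\cup Z$, where $Y$ is contained in a hypersurface $f=0$ and $Z$ is a collection of $e$ reduced points whose homogeneous coordinate ring has $a$-invariant $a'$. Then $$\mathfrak m^{a+2}+f\,\mathfrak m^{e}\subset\mathfrak m^{a+2}+f\,\mathfrak m^{a'+2}\subset\mathrm{core}(X)\subset\mathfrak m^{b+2}.$$
   Context: $k$ is an infinite field and $X=\{P_1,\dots,P_s\}$ is a set of $s$ reduced points in $\mathbb P^n_k$ (with coordinates in $k$). $S=k[x_0,\dots,x_n]$ is the polynomial ring, $I_X$ the homogeneous vanishing ideal of $X$, $R=S/I_X$ the homogeneous coordinate ring (a one-dimensional Cohen-Macaulay ring), $\mathfrak m$ its homogeneous maximal ideal, $\omega=\omega_R$ its graded canonical module (normalized by $\omega_S=S(-n-1)$). Set $a=a(R)=-\min\{i:[\omega]_i\ne0\}$ (the $a$-invariant, defined in the same way for any homogeneous coordinate ring) and $b=b(R)=-\min\{i:[\omega]_iR\text{ is a faithful }R\text{-module}\}$, where $[\omega]_iR$ is the submodule generated by the degree $i$ component. The form $f\in S$ is identified with its image in $R$. Powers of ideals with non-positive exponent are the unit ideal. Define $\mathrm{core}(X)=\mathrm{core}(\mathfrak m)$, where the core of an ideal $I$ is the intersection of all its reductions (ideals $K\subset I$ with $I^{r+1}=KI^r$ for some $r\ge0$). *)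

(* Defs.v *)
From HB Require Import structures.
From mathcomp Require Import all_boot all_order all_algebra.
From mathcomp Require Import finmap.
From mathcomp Require Import mpoly.

Set Implicit Arguments.
Unset Strict Implicit.
Unset Printing Implicit Defensive.

Import Order.TTheory GRing.Theory Num.Theory.
Local Open Scope ring_scope.

(** * Ideals, reductions and the core *)

Section Ideals.
Context {A : comNzRingType}.
Implicit Types (G I J K : A -> Prop).

Definition subideal I J : Prop := forall x, I x -> J x.

Definition is_ideal I : Prop :=
  [/\ I 0, (forall x y, I x -> I y -> I (x + y))
    & (forall c x, I x -> I (c * x))].

Definition ideal_gen G : A -> Prop :=
  fun x => forall J, is_ideal J -> subideal G J -> J x.

Definition ideal_add I J : A -> Prop :=
  fun x => exists y z, [/\ I y, J z & x = y + z].

Definition ideal_mul I J : A -> Prop :=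
  ideal_gen (fun x => exists y z, [/\ I y, J z & x = y * z]).

Definition ideal_scale (c : A) I : A -> Prop :=
  fun x => exists2 y, I y & x = c * y.

Fixpoint ideal_exp I (r : nat) : A -> Prop :=
  if r is r'.+1 then ideal_mul I (ideal_exp I r') else fun _ => True.

Definition ideal_expz I (z : int) : A -> Prop :=
  match z with Posz r => ideal_exp I r | Negz _ => fun _ => True end.

Definition is_reduction K I : Prop :=
  [/\ is_ideal K, subideal K I
    & exists r : nat,
        forall x, ideal_exp I r.+1 x <-> ideal_mul K (ideal_exp I r) x].

Definition core I : A -> Prop := fun x => forall K, is_reduction K I -> K x.

End Ideals.

Definition infinite_field (k : fieldType) : Prop :=
  forall s : seq k, exists x, x \notin s.

(** * Points of projective space and their homogeneous ideals *)

(* The k-rational points of P^n are the lines through 0 in k^(n+1). *)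
Notation ppoint k n := {L : {vspace 'rV[k]_n.+1} | \dim L == 1%N}.

Section ProjectiveSpace.
Variables (k : fieldType) (n : nat).
Notation S := {mpoly k[n.+1]}.

Definition vanishes_at (p : S) (P : ppoint k n) : Prop :=
  forall v, v \in val P -> p.@[fun i => v 0 i] = 0.

(* Only forms are tested on X: the ideal they generate is homogeneous. *)
Definition vanishing_ideal (X : {fset ppoint k n}) : S -> Prop :=
  ideal_gen (fun p => (exists d : nat, p \is d.-homog) /\
                      (forall P, P \in X -> vanishes_at p P)).

End ProjectiveSpace.

(** * The graded canonical module Ext^n_S(S/I, S(-n-1)) *)

Section CanonicalModule.
Variables (k : fieldType) (n : nat).
Notation S := {mpoly k[n.+1]}.

(* S has no nonzero form of negative degree. *)
Definition homog_of (t : int) (p : S) : Prop :=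
  match t with Posz d => p \is d.-homog | Negz _ => p = 0 end.

(* A graded resolution F_* -> S/I by free S-modules of finite rank, with
   F_i the sum over p < rk i of the S(- dg i p).  Elements of F_i are row
   vectors, so maps act by right multiplication: the differential
   F_(i+1) -> F_i is v |-> v *m diff i, and the augmentation F_0 -> S/I is
   v |-> v *m aug modulo I. *)
Record gfree_resolution (I : S -> Prop) := GFreeResolution {
  rk : nat -> nat;
  dg : forall i, 'I_(rk i) -> int;
  diff : forall i, 'M[S]_(rk i.+1, rk i);
  aug : 'cV[S]_(rk 0);
  diff_homog : forall i p q, homog_of (dg p - dg q) (diff i p q);
  aug_homog : forall p, homog_of (dg p) (aug p 0);
  aug_surj : exists v : 'rV[S]_(rk 0), I ((v *m aug) 0 0 - 1);
  exact_aug : forall v : 'rV[S]_(rk 0),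
    I ((v *m aug) 0 0) <-> exists u : 'rV[S]_(rk 1), v = u *m diff 0;
  exact_diff : forall i (v : 'rV[S]_(rk i.+1)),
    v *m diff i = 0 <-> exists u : 'rV[S]_(rk i.+2), v = u *m diff i.+1
}.

Section Ext.
Variables (I : S -> Prop) (F : gfree_resolution I).

(* An element of Hom_S(F_i, S(-n-1)) is the column w of the images of the
   basis elements; composing it with F_(i+1) -> F_i gives diff F i *m w. *)
Definition cocycle (i : nat) (w : 'cV[S]_(rk F i)) : Prop := diff F i *m w = 0.

Definition coboundary (i : nat) : 'cV[S]_(rk F i) -> Prop :=
  match i with
  | 0 => fun w => w = 0
  | j.+1 => fun w => exists u : 'cV[S]_(rk F j), w = diff F j *m u
  end.

(* w has degree t in Hom_S(F_i, S(-n-1)): it sends the p-th basis element, of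
   degree dg p, into S(-n-1)_(dg p + t) = S_(dg p + t - (n+1)). *)
Definition hom_degree (i : nat) (t : int) (w : 'cV[S]_(rk F i)) : Prop :=
  forall p, homog_of (dg p + t - n.+1%:Z) (w p 0).

(* The canonical module omega is the module of cocycles modulo coboundaries
   in cohomological degree n, which is the codimension of S/I in S when S/I
   has dimension one. *)
Definition omega_rep (t : int) (w : 'cV[S]_(rk F n)) : Prop :=
  cocycle w /\ hom_degree t w.

Definition omega_nonzero (t : int) : Prop :=
  exists2 w, omega_rep t w & ~ coboundary w.

(* Representatives of the elements of [omega]_t R. *)
Definition omega_span (t : int) (w : 'cV[S]_(rk F n)) : Prop :=
  exists (m : nat) (c : 'I_m -> S) (v : 'I_m -> 'cV[S]_(rk F n)),
    (forall j, omega_rep t (v j)) /\ w = \sum_j c j *: v j.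

(* Faithful over S/I: whatever annihilates [omega]_t R is zero modulo I. *)
Definition omega_faithful (t : int) : Prop :=
  forall g : S,
    (forall w, omega_span t w -> coboundary (g *: w)) -> I g.

Definition is_min (P : int -> Prop) (m : int) : Prop :=
  P m /\ forall i, P i -> m <= i.

Definition is_a_invariant (a : int) : Prop := is_min omega_nonzero (- a).

Definition is_b_invariant (b : int) : Prop := is_min omega_faithful (- b).

End Ext.
End CanonicalModule.

(* pi presents R as S/I. *)
Definition presents_quotient (k : fieldType) (n : nat) (R : comNzRingType)
    (pi : {rmorphism {mpoly k[n.+1]} -> R}) (I : {mpoly k[n.+1]} -> Prop) :
    Prop :=
  (forall r, exists p, pi p = r) /\ (forall p, pi p = 0 <-> I p).

Definition hmax_ideal (k : fieldType) (n : nat) (R : comNzRingType)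
    (pi : {rmorphism {mpoly k[n.+1]} -> R}) : R -> Prop :=
  ideal_gen (fun x => exists i : 'I_n.+1, x = pi 'X_i).

(* Main.v *)
Require Import Defs.
From HB Require Import structures.
From mathcomp Require Import all_boot all_order all_algebra.
From mathcomp Require Import finmap.
From mathcomp Require Import mpoly.
From mathcomp Require Import zify ring.
From Stdlib Require Import Classical.

Set Implicit Arguments.
Unset Strict Implicit.
Unset Printing Implicit Defensive.

Import Order.TTheory GRing.Theory Num.Theory.
Local Open Scope ring_scope.

(** Everything is reduced to values of forms at the points.  Fix a linear form
    [l] vanishing at no point of [X] and normalize coordinates by [l = 1].  A
    separator of [P] in degree [t] is a form of degree [t] that vanishes at all
    the other points of the set but not at [P].

    The module [omega] is read off from separators.  Let [A] be a finite set
    containing all the affine coordinates of the points, so that [X] lies in the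
    grid [A ^ n], a complete intersection cut out by the forms
    [G_j = prod_(a in A) (x_j - a * l)].  Iterating the connecting maps of the
    regular sequence [G_j] (Rees) turns [Ext^n (S/I, S)], computed from any
    graded free resolution, into the forms [q] with [q I] inside [(G)], modulo
    [(G)] ([cocycle_to_form], [form_to_cocycle]); such a [q] is determined by
    its values, which vanish on the grid outside the given points.  Duality on
    the grid, namely the residue theorem ([grid_residue]) and its converse
    ([grid_interpolation]), then identifies [omega] in degree [- t] with the
    linear relations between the values of the forms of degree [t] at the
    points.  Hence for [t > a] every point has a separator of degree [t]
    ([a_invariant_bounds]), whereas for [t <= b] no point has one
    ([b_invariant_relation]).

    A reduction [K] of [m] contains the class of some [y = l + h], where [l] is
    a linear form vanishing at no point and [h] has order at least two
    ([reduction_general_element]).  Where the forms of degree [i] separate the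
    points of [Z], a form of degree [i + 1] is congruent to a multiple of [l]
    modulo [I_Z], and multiplication by [f] sends [I_Z] into [I_X].  So a
    product [f * p], with [p] of order at least [a' + 2], can be divided by [y]
    with a remainder of larger order, until the remainder lies in a power of
    [m] contained in [K] ([reduction_contains]).  With [f = 1] and [Z = X] this
    is the inclusion of [m ^ (a + 2)].  The first inclusion of the theorem is
    the bound [a' + 2 <= e]: products of [e - 1] linear forms separate [e]
    points.

    In the other direction, each general linear form [l] generates a reduction,
    so a form [x] in the core is a multiple [l * g_l] for every such [l].  If
    its degree is at most [b + 1], each point [P] enters some relation [W]
    between the values of forms of the degree of [g_l], and
    [sum_Q W(Q) x(Q) / l(Q) = 0] for all general [l].  The functions [1 / l(Q)]
    of [l] are linearly independent ([inverse_linear_forms_free]), so [x(P) = 0]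
    at every point and [x = 0] in [R]. *)

(** * Infinite fields *)

Section InfiniteField.
Variables (k : fieldType) (k_infinite : infinite_field k).

Lemma infinite_field_uniq (s : seq k) (N : nat) :
  exists r : seq k, [/\ uniq r, size r = N & {in r, forall x, x \notin s}].
Proof.
elim: N => [|N [r [Ur Sr Nr]]]; first by exists [::].
have [x] := k_infinite (s ++ r); rewrite mem_cat negb_or => /andP[xs xr].
exists (x :: r); split; rewrite /= ?xr ?Sr // => y.
by rewrite inE => /predU1P[-> | /Nr].
Qed.

Lemma poly_eq0_cofinite (q : {poly k}) (s : seq k) :
  (forall x, x \notin s -> q.[x] = 0) -> q = 0.
Proof.
move=> q0; apply/eqP; apply/negP => /negP nz_q.
have [r [Ur Sr Nr]] := infinite_field_uniq s (size q).
have: (size r < size q)%N.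
  by apply: max_poly_roots => //; apply/allP=> x /Nr /q0 qx; apply/rootP.
by rewrite Sr ltnn.
Qed.

(** A general element of a linear family.  The functionals are dealt with one at
    a time, by moving along a line. *)
Lemma avoid_hyperplanes (V : lmodType k) (W : V -> Prop)
    (T : eqType) (phi : T -> V -> k) (s : seq T) :
  (forall i t u v, phi i (u + t *: v) = phi i u + t * phi i v) ->
  (forall t u v, W u -> W v -> W (u + t *: v)) ->
  (exists u, W u) ->
  (forall i, i \in s -> exists2 u, W u & phi i u != 0) ->
  exists2 u, W u & forall i, i \in s -> phi i u != 0.
Proof.
move=> phiL WL W0; elim: s => [|i s IHs] Hs; first by case: W0 => u; exists u.
have [j js|u Wu Nu] := IHs; first by apply: Hs; rewrite inE js orbT.
have [v Wv Nv] := Hs i (mem_head _ _).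
(* On the line u + t v each functional has at most one zero. *)
pose bad := [seq - phi j u / phi j v | j <- i :: s].
have [t t_bad] := k_infinite (0 :: bad).
move: t_bad; rewrite inE negb_or => /andP[nz_t t_bad].
exists (u + t *: v); first exact: WL.
move=> j j_s; rewrite phiL; apply: contraNneq t_bad => z.
have nz_v: phi j v != 0.
  apply: contraNneq Nv => zv; move: j_s; rewrite inE => /predU1P[<-|/Nu].
    by rewrite zv.
  by move: z; rewrite zv mulr0 addr0 => ->; rewrite eqxx.
apply/mapP; exists j => //; apply: (mulIf nz_v); rewrite divfK //.
by apply/eqP; rewrite -addr_eq0 addrC z.
Qed.

End InfiniteField.

(** * Homogeneous components indexed by integers *)

Section Components.
Variables (k : fieldType) (n : nat).
Notation S := {mpoly k[n.+1]}.

(** Integer degrees, so that the negative twists of a graded free module need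
    no case analysis: the component of negative degree is zero. *)
Definition hcomp (t : int) (p : S) : S :=
  \sum_(m <- msupp p | (mdeg m)%:Z == t) p@_m *: 'X_[m].

Lemma mcoeff_hcomp t p m :
  (hcomp t p)@_m = if (mdeg m)%:Z == t then p@_m else 0.
Proof.
rewrite /hcomp (raddf_sum (mcoeff m)) /=.
under eq_bigr => i _ do rewrite mcoeffZ mcoeffX.
have [mp|mp] := boolP (m \in msupp p); last first.
  rewrite (memN_msupp_eq0 mp) if_same big1_seq // => i /andP[_ ip].
  by case: eqVneq ip mp => [->->|] //; rewrite mulr0.
have [dm|dm] := eqVneq ((mdeg m)%:Z) t.
  rewrite big_mkcond (bigD1_seq m) ?msupp_uniq //= dm !eqxx mulr1 big1 ?addr0 //.
  by move=> i /negPf->; rewrite mulr0 if_same.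
rewrite big1 // => i /eqP di; case: eqVneq => [ei|]; rewrite ?mulr0 //.
by rewrite -ei di eqxx in dm.
Qed.

Lemma hcomp_is_linear t : linear (hcomp t).
Proof.
move=> c p q; apply/mpolyP=> m; rewrite mcoeffD mcoeffZ !mcoeff_hcomp.
by rewrite mcoeffD mcoeffZ; case: ifP => // _; rewrite mulr0 addr0.
Qed.
HB.instance Definition _ t :=
  GRing.isLinear.Build k S S _ (hcomp t) (hcomp_is_linear t).

Lemma homog_ofP t (p : S) :
  homog_of t p <-> (forall m, p@_m != 0 -> (mdeg m)%:Z = t).
Proof.
case: t => d /=.
  split=> [/dhomogP dp m|dp]; first by rewrite -mcoeff_msupp => /dp->.
  by apply/dhomogP=> m; rewrite mcoeff_msupp => /dp[].
split=> [-> m|dp]; first by rewrite mcoeff0 eqxx.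
by apply/mpolyP=> m; rewrite mcoeff0; apply/eqP/negPn/negP=> /dp; discriminate.
Qed.

Lemma homog_of0 t : homog_of t (0 : S).
Proof. by apply/homog_ofP=> m; rewrite mcoeff0 eqxx. Qed.

Lemma homog_of_hcomp t p : homog_of t (hcomp t p).
Proof. by apply/homog_ofP=> m; rewrite mcoeff_hcomp; case: ifP => [/eqP //|]; rewrite eqxx. Qed.

Lemma hcomp_homog s t (p : S) :
  homog_of s p -> hcomp t p = if s == t then p else 0.
Proof.
move/homog_ofP=> dp; apply/mpolyP=> m; rewrite mcoeff_hcomp.
have [p0 | /dp->] := eqVneq (p@_m) 0; last by case: ifP; rewrite ?mcoeff0.
by rewrite p0 if_same; case: ifP => _; rewrite ?p0 ?mcoeff0.
Qed.

Lemma hcomp_id t p : homog_of t p -> hcomp t p = p.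
Proof. by move/(hcomp_homog t)->; rewrite eqxx. Qed.

Lemma homog_ofD t (p q : S) : homog_of t p -> homog_of t q -> homog_of t (p + q).
Proof.
move=> /hcomp_id<- /hcomp_id<-; rewrite -raddfD; exact: homog_of_hcomp.
Qed.

Lemma homog_ofZ t c (p : S) : homog_of t p -> homog_of t (c *: p).
Proof. move=> /hcomp_id<-; rewrite -linearZ; exact: homog_of_hcomp. Qed.

Lemma homog_ofN t (p : S) : homog_of t p -> homog_of t (- p).
Proof. move=> /hcomp_id<-; rewrite -linearN; exact: homog_of_hcomp. Qed.

Lemma homog_of_sum t (T : Type) (r : seq T) (P : pred T) (E : T -> S) :
  (forall i, P i -> homog_of t (E i)) -> homog_of t (\sum_(i <- r | P i) E i).
Proof.
by move=> HE; apply: big_ind => //; [apply: homog_of0 | apply: homog_ofD].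
Qed.

Lemma homog_ofM s t (p q : S) :
  homog_of s p -> homog_of t q -> homog_of (s + t) (p * q).
Proof.
case: s => [d|d] /=; last by move=> -> _; rewrite mul0r; apply: homog_of0.
case: t => [e|e] /=; last by move=> _ ->; rewrite mulr0; apply: homog_of0.
exact: dhomogM.
Qed.

Lemma homog_of1 : homog_of 0 (1 : S).
Proof. exact: dhomog1. Qed.

Lemma homog_ofX i : homog_of 1 ('X_i : S).
Proof. by rewrite /= dhomogX /= mdeg1. Qed.

Lemma homog_of_exp t (p : S) d : homog_of t p -> homog_of (t *+ d) (p ^+ d).
Proof.
move=> hp; elim: d => [|d IHd]; first by rewrite mulr0n expr0; apply: homog_of1.
by rewrite exprS mulrS; apply: homog_ofM.
Qed.

Lemma homog_of_prod (T : Type) (r : seq T) (P : pred T) (t : T -> int)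
    (E : T -> S) : (forall i, P i -> homog_of (t i) (E i)) ->
  homog_of (\sum_(i <- r | P i) t i) (\prod_(i <- r | P i) E i).
Proof.
move=> HE; elim/big_rec2: _ => [|i y x Pi]; first exact: homog_of1.
by apply: homog_ofM; apply: HE.
Qed.

Lemma hcomp_partition (p : S) N : (msize p <= N)%N ->
  p = \sum_(e < N) hcomp e%:Z p.
Proof.
move=> pN; apply/mpolyP=> m; rewrite (raddf_sum (mcoeff m)) /=.
under eq_bigr => e _ do rewrite mcoeff_hcomp.
have [mN|mN] := ltnP (mdeg m) N.
  rewrite (bigD1 (Ordinal mN)) //= eqxx big1 ?addr0 // => i ni.
  by case: eqP => // -[em]; case/eqP: ni; apply/val_inj; rewrite /= em.
rewrite (memN_msupp_eq0 (msize_mdeg_ge (leq_trans pN mN))) big1 // => i _.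
by case: ifP.
Qed.

Lemma hcompM s t (x p : S) : homog_of s x -> hcomp (s + t) (x * p) = x * hcomp t p.
Proof.
move=> hx; rewrite [p in LHS](hcomp_partition (leqnn _)).
rewrite [p in RHS](hcomp_partition (leqnn _)).
rewrite mulr_sumr !raddf_sum /= mulr_sumr; apply: eq_bigr => e _.
rewrite (hcomp_homog _ (homog_ofM hx (homog_of_hcomp e%:Z p))).
rewrite (hcomp_homog _ (homog_of_hcomp e%:Z p)) (inj_eq (addrI _)).
by case: ifP => // _; rewrite mulr0.
Qed.

Lemma hcompMr s t (x p : S) :
  homog_of s x -> hcomp t (x * p) = x * hcomp (t - s) p.
Proof. by move=> hx; rewrite -(hcompM _ _ hx) addrC subrK. Qed.

Lemma mevalZ_homog d (p : S) c (v : 'I_n.+1 -> k) :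
  p \is d.-homog -> p.@[fun i => c * v i] = c ^+ d * p.@[v].
Proof.
move/dhomogP=> dp; rewrite !mevalE mulr_sumr; apply: eq_big_seq => m mp.
rewrite mulrCA; congr (_ * _).
have <- : mdeg m = d := dp m mp.
rewrite mdegE -prodrXr -big_split /=.
by apply: eq_bigr => i _; rewrite exprMn.
Qed.

Lemma mevalZ_hcomp (p : S) c (v : 'I_n.+1 -> k) N : (msize p <= N)%N ->
  p.@[fun i => c * v i] = (\poly_(e < N) (hcomp e%:Z p).@[v]).[c].
Proof.
move=> pN; rewrite {1}(hcomp_partition pN) raddf_sum /= horner_poly.
apply: eq_bigr => e _; rewrite mulrC; apply: mevalZ_homog.
exact: (homog_of_hcomp e%:Z p).
Qed.

(** A polynomial vanishing on a cone, all of its homogeneous components do: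
    the values along a line are those of a univariate polynomial whose
    coefficients are the values of the components. *)
Lemma hcomp_vanish (k_infinite : infinite_field k) (p : S) (v : 'I_n.+1 -> k) :
  (forall c, c != 0 -> p.@[fun i => c * v i] = 0) ->
  forall t, (hcomp t p).@[v] = 0.
Proof.
move=> p0 [e|e]; last first.
  by rewrite (_ : hcomp _ _ = 0) ?meval0 //; apply: (homog_of_hcomp (Negz e) p).
pose N := (maxn (msize p) e.+1).
have q0: \poly_(i < N) (hcomp i%:Z p).@[v] = 0.
  apply: (poly_eq0_cofinite k_infinite (s := [:: 0])) => c; rewrite inE => nz_c.
  by rewrite -mevalZ_hcomp ?leq_maxl ?p0.
have := coef_poly N (fun i => (hcomp i%:Z p).@[v]) e.
by rewrite q0 coef0 leq_maxr => ->.
Qed.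

End Components.

(** * Columns with entries in an ideal *)

Section IdealColumns.
Variables (A : comNzRingType) (J : A -> Prop) (J_ideal : is_ideal J).

Lemma is_ideal0 : J 0. Proof. by case: J_ideal. Qed.
Lemma is_idealD x y : J x -> J y -> J (x + y).
Proof. by case: J_ideal => _ + _; apply. Qed.
Lemma is_idealMl c x : J x -> J (c * x).
Proof. by case: J_ideal => _ _; apply. Qed.
Lemma is_idealMr c x : J x -> J (x * c).
Proof. by rewrite mulrC; apply: is_idealMl. Qed.
Lemma is_idealN x : J x -> J (- x).
Proof. by rewrite -mulN1r; apply: is_idealMl. Qed.
Lemma is_idealB x y : J x -> J y -> J (x - y).
Proof. by move=> Jx /is_idealN; apply: is_idealD. Qed.
Lemma is_ideal_sum (T : Type) (r : seq T) (P : pred T) (E : T -> A) :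
  (forall i, P i -> J (E i)) -> J (\sum_(i <- r | P i) E i).
Proof. by move=> HE; apply: big_ind => //; [apply: is_ideal0 | apply: is_idealD]. Qed.

Definition in_col m (w : 'cV[A]_m) : Prop := forall p, J (w p 0).

Lemma in_colB m (v w : 'cV[A]_m) : in_col v -> in_col w -> in_col (v - w).
Proof. by move=> Jv Jw p; rewrite !mxE; apply: is_idealB. Qed.

Lemma in_colD m (v w : 'cV[A]_m) : in_col v -> in_col w -> in_col (v + w).
Proof. by move=> Jv Jw p; rewrite !mxE; apply: is_idealD. Qed.

Lemma in_colN m (w : 'cV[A]_m) : in_col w -> in_col (- w).
Proof. by move=> Jw p; rewrite !mxE; apply: is_idealN. Qed.

Lemma in_colZ m c (w : 'cV[A]_m) : in_col w -> in_col (c *: w).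
Proof. by move=> Jw p; rewrite !mxE; apply: is_idealMl. Qed.

Lemma in_col_mul m l (N : 'M[A]_(l, m)) (w : 'cV[A]_m) :
  in_col w -> in_col (N *m w).
Proof. by move=> Jw p; rewrite !mxE; apply: is_ideal_sum => i _; apply: is_idealMl. Qed.

End IdealColumns.

Lemma rows_factor (A : comNzRingType) l m r (M : 'M[A]_(l, m)) (N : 'M[A]_(r, m)) :
  (forall p, exists u, row p M = u *m N) -> exists h, M = h *m N.
Proof.
move=> /fin_all_exists[u Hu]; exists (\matrix_p u p).
by apply/row_matrixP=> p; rewrite Hu row_mul rowK.
Qed.

(** * Cohomology of the dual of a resolution modulo a regular sequence *)

(** The ideals generated by the initial segments of a homogeneous regular
    sequence in [I].  They are predicates subject to [tower_step], and not
    generated ideals, because membership will be tested by evaluation. *)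
Record regular_tower (k : fieldType) (n : nat) (I : {mpoly k[n.+1]} -> Prop)
    (N : nat) (s : int) (J : nat -> {mpoly k[n.+1]} -> Prop)
    (G : nat -> {mpoly k[n.+1]}) : Prop := RegularTower {
  tower_ideal : forall r, is_ideal (J r);
  tower_graded : forall r t p, J r p -> J r (hcomp t p);
  tower_homog : forall r, homog_of s (G r);
  tower_in : forall r, (r < N)%N -> I (G r);
  tower_regular : forall r p, (r < N)%N -> J r (G r * p) -> J r p;
  tower_step : forall r p, (r < N)%N -> J r.+1 p <-> exists c, J r (p - c * G r)
}.

Section Rees.
Variables (k : fieldType) (n : nat).
Notation S := {mpoly k[n.+1]}.
Variables (I : S -> Prop) (F : gfree_resolution I).
Hypothesis I_ideal : is_ideal I.
Hypothesis I_graded : forall t p, I p -> I (hcomp t p).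

Notation D i := ('cV[S]_(rk F i)).

Lemma diff_diff i : diff F i.+1 *m diff F i = 0.
Proof.
apply/row_matrixP=> p; rewrite row_mul row0; apply/exact_diff.
by exists (delta_mx 0 p); rewrite -rowE.
Qed.

Lemma diff_aug_in p : I ((diff F 0 *m aug F) p 0).
Proof.
have -> : (diff F 0 *m aug F) p 0 = (row p (diff F 0) *m aug F) 0 0.
  by rewrite -row_mul [RHS]mxE.
by apply/exact_aug; exists (delta_mx 0 p); rewrite -rowE.
Qed.

Lemma homotopy0 x : I x -> exists h, x%:M = h *m diff F 0.
Proof.
move=> Ix; apply: rows_factor => p; apply/exact_aug.
rewrite -row_mul mul_scalar_mx !mxE; exact: is_idealMr.
Qed.

(** The hypothesis says that [x - diff *m h] is killed by the differential on its
    right, so that its rows lift one step further. *)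
Lemma homotopyS i x (h : 'M[S]_(rk F i, rk F i.+1)) :
  diff F i *m h *m diff F i = x *: diff F i ->
  exists h', x%:M = h' *m diff F i.+1 + diff F i *m h.
Proof.
move=> Hh; have [|h' Eh'] := @rows_factor _ _ _ _ (x%:M - diff F i *m h) (diff F i.+1).
  move=> p; apply/exact_diff.
  by rewrite -row_mul mulmxBl mul_scalar_mx Hh subrr row0.
by exists h'; rewrite -Eh' subrK.
Qed.

(** One step of a null-homotopy of the multiplication by [x], in the form needed
    to take the next one.  Such homotopies are the reason why [I] annihilates
    the cohomology of the dual complex. *)
Lemma homotopy i x : I x ->
  exists h : 'M[S]_(rk F i, rk F i.+1), diff F i *m h *m diff F i = x *: diff F i.
Proof.
move=> Ix; elim: i => [|i [h Hh]].
  have [h Hh] := homotopy0 Ix; exists h.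
  by rewrite -mulmxA -Hh mul_mx_scalar.
have [h' Hh'] := homotopyS Hh; exists h'; rewrite -mulmxA.
have -> : h' *m diff F i.+1 = x%:M - diff F i *m h by rewrite Hh' addrK.
by rewrite mulmxBr mul_mx_scalar mulmxA diff_diff mul0mx subr0.
Qed.

(** A column of height [rk F i] is an element of the dual of the [i]-th free
    module; these are the coboundaries of the dual complex over [S / J]. *)
Definition bdry (J : S -> Prop) (i : nat) : D i -> Prop :=
  match i with
  | 0 => fun w => in_col J w
  | j.+1 => fun w => exists u : D j, in_col J (w - diff F j *m u)
  end.

(** The degree [t] is taken in the dual of the resolution itself, without the
    shift by [n + 1] of the canonical module. *)
Definition hom_col i (t : int) (w : D i) : Prop := forall p, homog_of (dg p + t) (w p 0).

Definition hcomp_col i (t : int) (w : D i) : D i := \col_p hcomp (dg p + t) (w p 0).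

Lemma hom_hcomp_col i t w : @hom_col i t (hcomp_col t w).
Proof. by move=> p; rewrite mxE; apply: homog_of_hcomp. Qed.

Lemma diff_hcomp_col i t (w : D i) :
  diff F i *m hcomp_col t w = hcomp_col t (diff F i *m w).
Proof.
apply/colP=> p; rewrite !mxE raddf_sum; apply: eq_bigr => q _ /=.
rewrite !mxE (hcompMr _ _ (diff_homog p q)); congr (_ * hcomp _ _).
by lia.
Qed.

Section Step.
Variables (J : S -> Prop) (x : S).
Hypothesis J_ideal : is_ideal J.
Hypothesis x_regular : forall p, J (x * p) -> J p.
Let Jx p := exists c, J (p - c * x).

Lemma in_col_add m (w : 'cV[S]_m) : in_col Jx w -> exists c, in_col J (w - x *: c).
Proof.
move=> /fin_all_exists[c Hc]; exists (\col_p c p) => p.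
by rewrite !mxE mulrC; apply: Hc.
Qed.

Lemma in_col_addI m (w c : 'cV[S]_m) : in_col J (w - x *: c) -> in_col Jx w.
Proof. by move=> H p; exists (c p 0); move: (H p); rewrite !mxE mulrC. Qed.

Lemma in_col_regular m (w : 'cV[S]_m) : in_col J (x *: w) -> in_col J w.
Proof. by move=> H p; apply: x_regular; move: (H p); rewrite !mxE. Qed.

(** The relation [in_col J (x *: w - diff F i *m u)] is the connecting map of
    [0 -> S/J -> S/J -> S/(J + x) -> 0] read backwards: it links a cocycle [w]
    modulo [J] to a cocycle [u] one step below modulo [J + (x)].  Since [x]
    annihilates the cohomology of [S / I], every [w] is linked to some [u], and
    every [u] to some [w]. *)
Lemma step_down i (w : D i.+1) : I x -> in_col J (diff F i.+1 *m w) ->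
  exists u : D i, in_col J (x *: w - diff F i *m u).
Proof.
move=> Ix Jw; have [h Hh] := homotopy i Ix; have [h' Hh'] := homotopyS Hh.
exists (h *m w); rewrite -mul_scalar_mx Hh' mulmxDl !mulmxA addrK -mulmxA.
exact: in_col_mul.
Qed.

Lemma link_cocycle i (w : D i.+1) (u : D i) :
  in_col J (x *: w - diff F i *m u) -> in_col Jx (diff F i *m u).
Proof.
by move=> H; apply: (in_col_addI (c := w)); rewrite -opprB; apply: in_colN.
Qed.

Lemma step_up i (u : D i) : in_col Jx (diff F i *m u) ->
  exists w : D i.+1, in_col J (x *: w - diff F i *m u).
Proof.
move=> /in_col_add[w Hw]; exists w; rewrite -opprB; exact: in_colN.
Qed.

Lemma link_cocycleI i (w : D i.+1) (u : D i) :
  in_col J (x *: w - diff F i *m u) -> in_col J (diff F i.+1 *m w).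
Proof.
move=> H; apply: in_col_regular; have := in_col_mul J_ideal (diff F i.+1) H.
by rewrite mulmxBr -scalemxAr mulmxA diff_diff mul0mx subr0.
Qed.

(** Injectivity from [w] to [u], together with the action of a polynomial [g]:
    a boundary modulo [J + (x)] is a boundary modulo [J] up to a multiple of
    [x], and the factor [x] can be cancelled. *)
Lemma link_bdry i (w : D i.+1) (u : D i) g :
  in_col J (x *: w - diff F i *m u) -> bdry Jx (g *: u) -> bdry J (g *: w).
Proof.
move=> Hwu Hu.
have [u' Hu']: exists u', in_col J (diff F i *m (g *: u - x *: u')).
  case: i w u Hwu Hu => [|i] w u _ /=.
    by move=> /in_col_add[c Hc]; exists c; apply: in_col_mul.
  case=> v /in_col_add[c Hc]; exists c.
  have := in_col_mul J_ideal (diff F i.+1) Hc.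
  by rewrite !mulmxBr mulmxA diff_diff mul0mx subr0.
exists u'; apply: in_col_regular; have := in_colZ J_ideal g Hwu => H.
have := in_colD J_ideal H Hu'.
rewrite mulmxBr -!scalemxAr !scalerBr !scalerA.
by rewrite [g * x]mulrC addrA subrK.
Qed.

(** Conversely, if [w = diff v] then [u - x *: v] is a cocycle modulo [J]; this is
    where the vanishing of the cohomology one step below is needed. *)
Lemma link_bdryI i (w : D i.+1) (u : D i) :
  (forall v : D i, in_col J (diff F i *m v) -> bdry J v) ->
  in_col J (x *: w - diff F i *m u) -> bdry J w -> bdry Jx u.
Proof.
move=> vanish Hwu [v Hv].
have /vanish : in_col J (diff F i *m (u - x *: v)).
  have := in_colB J_ideal (in_colZ J_ideal x Hv) Hwu.
  by rewrite mulmxBr -scalemxAr scalerBr opprB [_ + (_ - _)]addrC addrA subrK.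
case: i w u v vanish Hwu Hv => [|i] w u v _ _ _ /=.
  exact: in_col_addI.
case=> v' H; exists v'; apply: (in_col_addI (c := v)).
by rewrite addrAC.
Qed.

Lemma regular_cocycle0 (w : D 0) : I x -> in_col J (diff F 0 *m w) -> in_col J w.
Proof.
move=> Ix Jw; have [h Hh] := homotopy0 Ix; apply: in_col_regular.
by rewrite -mul_scalar_mx Hh -mulmxA; apply: in_col_mul.
Qed.

Hypothesis J_graded : forall t p, J p -> J (hcomp t p).

Lemma link_hcomp_col i t s (w : D i.+1) (u : D i) :
  homog_of s x -> in_col J (x *: w - diff F i *m u) ->
  in_col J (x *: hcomp_col t w - diff F i *m hcomp_col (t + s) u).
Proof.
rewrite diff_hcomp_col; move: (diff F i *m u) => z hx H p.
move: (H p); rewrite !mxE => /(J_graded (dg p + (t + s))).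
rewrite raddfB /= (_ : dg p + (t + s) = s + (dg p + t)); last by lia.
by rewrite (hcompM _ _ hx).
Qed.

End Step.

Lemma hcomp_col_id i t (w : D i) : hom_col t w -> hcomp_col t w = w.
Proof. by move=> hw; apply/colP=> p; rewrite mxE hcomp_id. Qed.

Lemma aug_surj_homog :
  exists2 v : 'rV[S]_(rk F 0), (forall p, homog_of (- dg p) (v 0 p))
    & I ((v *m aug F) 0 0 - 1).
Proof.
have [v Hv] := aug_surj F; exists (\row_p hcomp (- dg p) (v 0 p)).
  by move=> p; rewrite mxE; apply: homog_of_hcomp.
have := I_graded 0 Hv; rewrite raddfB /= (hcomp_id (homog_of1 k n)).
rewrite !mxE raddf_sum /=; congr (I (_ - _)).
apply: eq_bigr => p _; rewrite mxE !(mulrC _ (aug F p 0)).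
by rewrite (hcompMr _ _ (aug_homog p)) sub0r.
Qed.

Variables (N : nat) (s : int) (J : nat -> S -> Prop) (G : nat -> S).
Hypothesis tower : regular_tower I N s J G.

Let J_ideal r : is_ideal (J r) := tower_ideal tower r.
Let J_graded r t p : J r p -> J r (hcomp t p) := @tower_graded _ _ _ _ _ _ _ tower r t p.
Let G_homog r : homog_of s (G r) := tower_homog tower r.
Let G_in r : (r < N)%N -> I (G r) := @tower_in _ _ _ _ _ _ _ tower r.
Let G_regular r p : (r < N)%N -> J r (G r * p) -> J r p :=
  @tower_regular _ _ _ _ _ _ _ tower r p.
Let J_step r p : (r < N)%N -> J r.+1 p <-> exists c, J r (p - c * G r) :=
  @tower_step _ _ _ _ _ _ _ tower r p.

Lemma in_col_step r m (w : 'cV[S]_m) : (r < N)%N ->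
  in_col (J r.+1) w <-> in_col (fun p => exists c, J r (p - c * G r)) w.
Proof. by move=> rN; split=> H p; apply/(J_step _ rN). Qed.

Lemma bdry_step r i (w : D i) : (r < N)%N ->
  bdry (J r.+1) w <-> bdry (fun p => exists c, J r (p - c * G r)) w.
Proof.
move=> rN; case: i w => [|i] w /=; first exact: in_col_step.
by split=> -[u Hu]; exists u; apply/(in_col_step _ rN).
Qed.

(** Rees: the cohomology modulo [J r] vanishes below the length of the rest of
    the regular sequence. *)
Lemma bdry_of_cocycle i r (w : D i) : (i + r < N)%N ->
  in_col (J r) (diff F i *m w) -> bdry (J r) w.
Proof.
elim: i r w => [|i IHi] r w irN Hw.
  apply: (regular_cocycle0 (J_ideal r) (x := G r)) => //; last exact: G_in.
  by move=> p; apply: G_regular.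
have rN : (r < N)%N by lia.
have [u Hu] := step_down (J_ideal r) (G_in rN) Hw.
rewrite -(scale1r w); apply: (link_bdry (J_ideal r) _ Hu).
  by move=> p; apply: G_regular.
rewrite scale1r; apply/(bdry_step _ rN)/IHi; first by lia.
apply/(in_col_step _ rN); exact: (link_cocycle (J_ideal r) Hu).
Qed.

(** Iterating the connecting map down to degree zero gives
    [Ext^i (S/I, S/J r) = Hom (S/I, S/J N)], whose elements are the [q] with
    [q I] inside [J N].  The last clause is injectivity, in a form that also
    records the annihilators of the class of [w]. *)
Lemma cocycle_to_form i r t (w : D i) : (i + r = N)%N ->
  in_col (J r) (diff F i *m w) -> hom_col t w ->
  exists q, [/\ homog_of (t + s *+ i) q, forall y, I y -> J N (q * y)
    & forall g, J N (g * q) -> bdry (J r) (g *: w)].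
Proof.
elim: i r t w => [|i IHi] r t w irN Hw hw.
  rewrite add0n in irN; subst r.
  have [v hv Hv] := aug_surj_homog.
  exists ((v *m w) 0 0); split.
  - rewrite mulr0n addr0 mxE; apply: homog_of_sum => p _.
    have -> : t = - dg p + (dg p + t) by lia.
    exact: homog_ofM.
  - move=> y Iy.
    have /exact_aug[u Eu]: I (((y *: v) *m aug F) 0 0).
      by rewrite -scalemxAl mxE; apply: is_idealMr.
    have -> : (v *m w) 0 0 * y = (u *m (diff F 0 *m w)) 0 0.
      by rewrite mulmxA -Eu -scalemxAl !mxE mulrC.
    exact: (in_col_mul (J_ideal N) u Hw).
  - move=> g Jg p; rewrite mxE.
    (* Modulo the image of the differential, the p-th basis vector is
       aug p times the chosen preimage of 1. *)
    have /exact_aug[u Eu]: I (((delta_mx 0 p - aug F p 0 *: v) *m aug F) 0 0).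
      rewrite mulmxBl -scalemxAl -rowE !mxE.
      set z := \sum_(j < _) _.
      have -> : aug F p 0 - aug F p 0 * z = - aug F p 0 * (z - 1) by ring.
      by apply: is_idealMl => //; move: Hv; rewrite mxE.
    have: J N ((u *m (diff F 0 *m w)) 0 0) := in_col_mul (J_ideal N) u Hw 0.
    rewrite mulmxA -Eu mulmxBl -scalemxAl -rowE => /(is_idealMl (J_ideal N) g) H.
    have := is_idealD (J_ideal N) H (is_idealMl (J_ideal N) (aug F p 0) Jg).
    congr (J N _); rewrite ![in LHS]mxE; set z := \sum_(j < _) _.
    by ring.
have rN : (r < N)%N by lia.
have [u0 Hu0] := step_down (J_ideal r) (G_in rN) Hw.
have := link_hcomp_col (J_graded (r := r)) t (G_homog r) Hu0.
rewrite hcomp_col_id //; set u := hcomp_col _ u0 => Hu.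
have [||q [hq Iq Bq]] := IHi r.+1 (t + s) u _ _ (hom_hcomp_col _ _).
- by lia.
- apply/(in_col_step _ rN); exact: (link_cocycle (J_ideal r) Hu).
exists q; split=> //.
  by rewrite (_ : t + s *+ i.+1 = t + s + s *+ i) // mulrS addrA.
move=> g /Bq /(bdry_step _ rN); apply: (link_bdry (J_ideal r) _ Hu).
by move=> p; apply: G_regular.
Qed.

(** Surjectivity of the same map.  The last clause, that the class of [w] is
    trivial only if that of [q] is, rests on the vanishing in lower degrees. *)
Lemma form_to_cocycle i r t q : (i + r = N)%N ->
  homog_of (t + s *+ i) q -> (forall y, I y -> J N (q * y)) ->
  exists w : D i, [/\ in_col (J r) (diff F i *m w), hom_col t w
    & bdry (J r) w -> J N q].
Proof.
elim: i r t => [|i IHi] r t irN hq Iq.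
  rewrite add0n in irN; subst r.
  exists (q *: aug F); split.
  - by move=> p; rewrite -scalemxAr mxE; apply/Iq/diff_aug_in.
  - move=> p; rewrite mxE mulrC; apply: homog_ofM; first exact: aug_homog.
    by rewrite mulr0n addr0 in hq.
  - move=> /(in_col_mul (J_ideal N)) H; have [v Hv] := aug_surj F.
    have := is_idealB (J_ideal N) (H _ v 0) (Iq _ Hv).
    by rewrite -scalemxAr mxE mulrBr opprB mulr1 addrC subrK.
have rN : (r < N)%N by lia.
have [||u [Hu hu Bu]] := IHi r.+1 (t + s) _ _ Iq; first by lia.
  by rewrite mulrS addrA in hq.
have /(in_col_step _ rN)/(step_up (J_ideal r))[w0 Hw0] := Hu.
have := link_hcomp_col (J_graded (r := r)) t (G_homog r) Hw0.
rewrite (hcomp_col_id hu); set w := hcomp_col _ w0 => Hw.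
have G_reg p : J r (G r * p) -> J r p by apply: G_regular.
exists w; split; first exact: (link_cocycleI (J_ideal r) G_reg Hw).
  exact: hom_hcomp_col.
move=> Bw; apply/Bu/(bdry_step _ rN).
apply: (link_bdryI (J_ideal r) _ Hw Bw) => v.
by apply: bdry_of_cocycle; lia.
Qed.

End Rees.

(** * Polynomials as functions *)

Section PolynomialFunctions.
Variable k : fieldType.

Lemma mpoly_ring_ind m (P : {mpoly k[m]} -> Prop) :
  (forall c, P c%:MP) -> (forall i, P 'X_i) ->
  (forall p q, P p -> P q -> P (p + q)) -> (forall p q, P p -> P q -> P (p * q)) ->
  forall p, P p.
Proof.
move=> PC PX PD PM; have P0 : P 0 by rewrite -mpolyC0.
elim/mpolyind=> // c mu p _ _ Pp; apply: (PD) => //; rewrite -mul_mpolyC.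
apply: (PM) => //; rewrite mpolyXE_id; apply: big_ind => [||i _].
- by rewrite -mpolyC1.
- exact: PM.
elim: (mu i) => [|e IHe]; first by rewrite expr0 -mpolyC1.
by rewrite exprS; apply: PM.
Qed.

Lemma base_expansion_inj N m (a b : 'I_m -> nat) :
  (forall i, (a i < N)%N) -> (forall i, (b i < N)%N) ->
  (\sum_i a i * N ^ i = \sum_i b i * N ^ i)%N -> a =1 b.
Proof.
elim: m a b => [|m IHm] a b aN bN; first by move=> _ [].
rewrite !big_ord_recl /= expn0 !muln1.
have bumpE (c : 'I_m.+1 -> nat) :
    (\sum_(i < m) c (lift ord0 i) * N ^ bump 0 i =
     (\sum_(i < m) c (lift ord0 i) * N ^ i) * N)%N.
  by rewrite big_distrl; apply: eq_bigr => i _; rewrite /= /bump add1n expnSr mulnA.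
rewrite !bumpE => e.
have e0 : a ord0 = b ord0.
  have := congr1 (modn^~ N) e.
  by rewrite /= ![(_ + _ * N)%N]addnC !modnMDl !modn_small.
move: e; rewrite e0 => /addnI /eqP; rewrite eqn_pmul2r ?(leq_trans _ (aN ord0)) //.
move=> /eqP /IHm e i; case: (unliftP ord0 i) => [j ->|->] //.
by apply: e => j'.
Qed.

(** Kronecker substitution [X_i -> T ^ (N ^ i)], which separates the monomials
    of a polynomial when [N] exceeds its degree. *)
Lemma mpoly_eq0_fun (k_infinite : infinite_field k) m (p : {mpoly k[m]}) :
  (forall v, p.@[v] = 0) -> p = 0.
Proof.
move=> p0; pose N := msize p; pose K (mu : 'X_{1..m}) := (\sum_i mu i * N ^ i)%N.
pose q := \sum_(mu <- msupp p) p@_mu *: 'X^(K mu) : {poly k}.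
have q0 : q = 0.
  apply: (poly_eq0_cofinite k_infinite (s := [::])) => x _.
  rewrite -[RHS](p0 (fun i => x ^+ (N ^ i))) mevalE /q horner_sum.
  apply: eq_bigr => mu _; rewrite hornerZ hornerXn; congr (_ * _).
  by rewrite /K -prodrXr; apply: eq_bigr => i _; rewrite -exprM mulnC.
apply/mpolyP=> mu; rewrite mcoeff0; apply/eqP/negPn/negP; rewrite -mcoeff_msupp => mu_p.
have small nu : nu \in msupp p -> forall i, (nu i < N)%N.
  move=> /msize_mdeg_lt lt_N i; apply: leq_ltn_trans lt_N; rewrite mdegE.
  by rewrite (bigD1 i) //= leq_addr.
have := congr1 (fun r : {poly k} => r`_(K mu)) q0.
rewrite /q coef_sum coef0 (bigD1_seq mu) ?msupp_uniq //= coefZ coefXn eqxx mulr1.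
rewrite big1_seq ?addr0 => [pmu|nu /andP[nu_mu nu_p]].
  by move: mu_p; rewrite mcoeff_msupp pmu eqxx.
rewrite coefZ coefXn; case: eqP => [e|]; last by rewrite mulr0.
case/eqP: nu_mu; apply/mnmP => i; apply/esym.
exact: (base_expansion_inj (small _ mu_p) (small _ nu_p) e).
Qed.

Lemma meval_line m (p : {mpoly k[m]}) (v e : 'I_m -> k) :
  exists q : {poly k}, forall t, q.[t] = p.@[fun i => v i + t * e i].
Proof.
move: p; apply: mpoly_ring_ind => [c|i|p q [P HP] [Q HQ]|p q [P HP] [Q HQ]].
- by exists c%:P => t; rewrite hornerC mevalC.
- exists ((v i)%:P + e i *: 'X) => t.
  by rewrite !hornerE mevalXU mulrC.
- by exists (P + Q) => t; rewrite hornerD mevalD HP HQ.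
- by exists (P * Q) => t; rewrite hornerM mevalM HP HQ.
Qed.

(** A polynomial and its translate by [- x * e] are congruent modulo [x]; this is
    clear for the variables and is preserved by sums and products. *)
Lemma shift_congr m (p x : {mpoly k[m]}) (e : 'I_m -> k) :
  exists q r : {mpoly k[m]}, p = r + x * q /\
    forall v, r.@[v] = p.@[fun i => v i - x.@[v] * e i].
Proof.
move: p; apply: mpoly_ring_ind => [c|i|p q|p q].
- by exists 0, c%:MP; split=> [|v]; rewrite ?mulr0 ?addr0 // !mevalC.
- exists (e i)%:MP, ('X_i - x * (e i)%:MP); split=> [|v]; first by rewrite subrK.
  by rewrite mevalB mevalM !mevalXU mevalC.
- case=> [p' [p0 [-> Hp]]] [q' [q0 [-> Hq]]].
  exists (p' + q'), (p0 + q0); split=> [|v]; first by ring.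
  by rewrite !mevalD in Hp Hq *; rewrite Hp Hq !mevalD.
- case=> [p' [p0 [Ep Hp]]] [q' [q0 [Eq Hq]]].
  exists (p' * q + p0 * q'), (p0 * q0); split=> [|v].
    by rewrite Ep Eq; ring.
  by rewrite !mevalM Hp Hq.
Qed.

End PolynomialFunctions.

(** * Cylinders over a grid *)

Section Cylinders.
Variables (k : fieldType) (k_infinite : infinite_field k) (n : nat).
Notation S := {mpoly k[n.+1]}.
Notation var j := (lift ord0 j : 'I_n.+1).
Variables (c : 'I_n -> k) (A : seq k).
Hypothesis A_uniq : uniq A.

(** The hyperplane at infinity.  Its equation is monic in the first variable, so
    that the other variables are affine coordinates on its complement. *)
Definition level (v : 'I_n.+1 -> k) : k := v ord0 + \sum_j c j * v (var j).
Definition level_form : S := 'X_ord0 + \sum_j c j *: 'X_(var j).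

Lemma meval_level_form v : level_form.@[v] = level v.
Proof.
rewrite mevalD mevalXU raddf_sum; congr (_ + _).
by apply: eq_bigr => j _ /=; rewrite mevalZ mevalXU.
Qed.

Lemma homog_level_form : homog_of 1 level_form.
Proof.
apply: homog_ofD; first exact: homog_ofX.
by apply: homog_of_sum => j _; apply/homog_ofZ/homog_ofX.
Qed.

Lemma levelZ t v : level (fun i => t * v i) = t * level v.
Proof.
rewrite /level mulrDr mulr_sumr; congr (_ + _).
by apply: eq_bigr => j _; rewrite mulrCA.
Qed.

(** The direction along which only the [j]-th affine coordinate changes. *)
Definition dir (j : 'I_n) (i : 'I_n.+1) : k :=
  if unlift ord0 i is Some j' then (j' == j)%:R else - c j.

Lemma dir_var j j' : dir j (var j') = (j' == j)%:R.
Proof. by rewrite /dir liftK. Qed.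

Lemma level_dir v t j : level (fun i => v i + t * dir j i) = level v.
Proof.
rewrite /level {1}/dir unlift_none.
under eq_bigr => j' _ do rewrite dir_var mulrDr.
have H : \sum_j' c j' * (t * (j' == j)%:R) = t * c j.
  rewrite (bigD1 j) //= eqxx mulr1 big1 ?addr0 1?mulrC // => j' /negPf->.
  by rewrite !mulr0.
by rewrite big_split /= H; ring.
Qed.

(** The cone over the product of the grid [A ^ r] with an affine space. *)
Definition in_cylinder (r : nat) (v : 'I_n.+1 -> k) : Prop :=
  level v != 0 /\ forall j : 'I_n, (j < r)%N -> v (var j) / level v \in A.

(** Defined by vanishing: homogeneity and regularity then are statements about
    values, and [cylinder_ideal_step] recovers the generators. *)
Definition cylinder_ideal (r : nat) (p : S) : Prop :=
  forall v, in_cylinder r v -> p.@[v] = 0.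

Definition grid_form (B : seq k) (j : 'I_n) : S :=
  \prod_(a <- B) ('X_(var j) - a *: level_form).

Definition cylinder_form (r : nat) : S :=
  if insub r is Some j then grid_form A j else 0.

Lemma meval_grid_form B j v :
  (grid_form B j).@[v] = \prod_(a <- B) (v (var j) - a * level v).
Proof.
rewrite rmorph_prod; apply: eq_bigr => a _.
by rewrite /= mevalB mevalZ mevalXU meval_level_form.
Qed.

Lemma homog_grid_form B j : homog_of (size B)%:Z (grid_form B j).
Proof.
have -> : (size B)%:Z = \sum_(a <- B) 1.
  by rewrite big_const_seq count_predT iter_addr_0 -[RHS]/(_%:R) natz.
apply: homog_of_prod => a _; apply: homog_ofD; first exact: homog_ofX.
exact/homog_ofN/homog_ofZ/homog_level_form.
Qed.

Lemma homog_cylinder_form r : homog_of (size A)%:Z (cylinder_form r).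
Proof.
by rewrite /cylinder_form; case: insub => [j|]; [apply: homog_grid_form | apply: homog_of0].
Qed.

Lemma cylinder_ideal_ideal r : is_ideal (cylinder_ideal r).
Proof.
split=> [v _|p q Jp Jq v Hv|q p Jp v Hv]; first by rewrite meval0.
  by rewrite mevalD Jp // Jq // addr0.
by rewrite mevalM Jp // mulr0.
Qed.

Lemma in_cylinderZ r t v : t != 0 -> in_cylinder r v ->
  in_cylinder r (fun i => t * v i).
Proof.
move=> nz_t [nz_v Hv]; split; first by rewrite levelZ mulf_neq0.
by move=> j /Hv; rewrite levelZ -mulf_div divff // mul1r.
Qed.

Lemma cylinder_ideal_graded r t p :
  cylinder_ideal r p -> cylinder_ideal r (hcomp t p).
Proof.
by move=> Jp v Hv; apply: hcomp_vanish => // x nz_x; apply: Jp; apply: in_cylinderZ.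
Qed.

Lemma cylinder_ideal0 p : cylinder_ideal 0 p -> p = 0.
Proof.
move=> Jp; have /eqP: level_form * p = 0.
  apply: (mpoly_eq0_fun k_infinite) => v; rewrite mevalM meval_level_form.
  have [->|nz_v] := eqVneq (level v) 0; first by rewrite mul0r.
  by rewrite Jp ?mulr0.
rewrite mulf_eq0 => /orP[|/eqP//] /eqP l0.
have := meval_level_form (fun i => (i == ord0)%:R); rewrite l0 meval0 /level eqxx.
rewrite big1 ?addr0 => [/eqP|j _]; last by rewrite mulr0.
by rewrite eq_sym oner_eq0.
Qed.

Lemma in_cylinder_dir (j : 'I_n) r t v :
  (r <= j)%N -> in_cylinder r v -> in_cylinder r (fun i => v i + t * dir j i).
Proof.
move=> rj [nz_v Hv]; split=> [|j' j'r]; rewrite level_dir // dir_var.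
have /negPf-> : j' != j by apply: contraTneq j'r => ->; rewrite -leqNgt.
by rewrite mulr0 addr0; apply: Hv.
Qed.

(** The cylinder is a union of lines in the direction of the [r]-th coordinate,
    and the form has finitely many zeros on each of them. *)
Lemma cylinder_ideal_regular r p : (r < n)%N ->
  cylinder_ideal r (cylinder_form r * p) -> cylinder_ideal r p.
Proof.
move=> rn; rewrite /cylinder_form insubT => /= Jp v Hv; set j := Sub r rn in Jp.
have [q Hq] := meval_line p v (dir j).
have [g Hg] := meval_line (grid_form A j) v (dir j).
have : g * q = 0.
  apply: (poly_eq0_cofinite k_infinite (s := [::])) => t _.
  rewrite hornerM Hg Hq -mevalM; apply: Jp; exact: in_cylinder_dir.
move/eqP; rewrite mulf_eq0 => /orP[] /eqP z.
  have [t] := k_infinite [seq a * level v - v (var j) | a <- A].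
  case/negP; have /eqP := Hg t; rewrite z horner0 meval_grid_form eq_sym.
  rewrite prodf_seq_eq0 => /hasP[a aA /=]; rewrite level_dir dir_var eqxx mulr1.
  rewrite subr_eq0 => /eqP e; apply/mapP; exists a => //.
  by rewrite -e addrAC subrr add0r.
have := Hq 0; rewrite z horner0 => ->; apply: meval_eq => i.
by rewrite mul0r addr0.
Qed.

(** Removing one node [a] at a time: translating [p] along [dir j] onto the
    hyperplane of [a] yields a polynomial that vanishes on the whole cylinder
    and is congruent to [p] modulo the linear form of [a]. *)
Lemma grid_form_gen (B : seq k) (j : 'I_n) p : uniq B ->
  (forall v, in_cylinder j v -> v (var j) / level v \in B -> p.@[v] = 0) ->
  exists q, cylinder_ideal j (p - q * grid_form B j).
Proof.
elim: B p => [|a B IHB] p /=.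
  move=> _ _; exists p => v _; rewrite /grid_form big_nil mulr1 subrr.
  by rewrite meval0.
move=> /andP[aB UB] Hp; pose x := 'X_(var j) - a *: level_form.
have [q [r [Ep Hr]]] := shift_congr p x (dir j).
have xE v : x.@[v] = v (var j) - a * level v.
  by rewrite mevalB mevalXU mevalZ meval_level_form.
have Jr : cylinder_ideal j r.
  move=> v Hv; rewrite Hr xE.
  rewrite (meval_eq (v2 := fun i => v i + (a * level v - v (var j)) * dir j i)).
    apply: Hp; first exact: in_cylinder_dir.
    rewrite level_dir dir_var eqxx mulr1 addrC subrK mulfK ?mem_head //.
    by case: Hv.
  by move=> i; rewrite -mulNr opprB.
have [v Hv vB|q' Hq'] := IHB q UB.
  have /eqP: (x * q).@[v] = 0.
    have -> : x * q = p - r by rewrite Ep addrAC subrr add0r.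
    by rewrite mevalB Jr // subr0; apply: Hp => //; rewrite inE vB orbT.
  rewrite mevalM mulf_eq0 xE subr_eq0 => /orP[/eqP e|/eqP//].
  by move: vB aB; rewrite e mulfK; [move=> -> | case: Hv].
exists q' => v Hv; rewrite /grid_form big_cons -/(grid_form B j) -/x Ep.
have -> : r + x * q - q' * (x * grid_form B j) = r + x * (q - q' * grid_form B j).
  by ring.
by rewrite mevalD mevalM Jr // Hq' // mulr0 addr0.
Qed.

Lemma cylinder_ideal_step r p : (r < n)%N ->
  cylinder_ideal r.+1 p <-> exists q, cylinder_ideal r (p - q * cylinder_form r).
Proof.
move=> rn; rewrite /cylinder_form insubT /=; set j := Sub r rn.
have jr : j = r :> nat by [].
split=> [Jp|[q Hq] v [nz_v Hv]].
  rewrite -jr; apply: grid_form_gen => // v [nz_v Hv] vj; apply: Jp; split=> // j'.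
  rewrite ltnS leq_eqVlt => /predU1P[e|]; last exact: Hv.
  by rewrite (_ : j' = j) //; apply/val_inj.
have /Hq/eqP: in_cylinder r v by split=> // j' j'r; apply: Hv; apply: ltnW.
rewrite mevalB mevalM meval_grid_form (bigD1_seq (v (var j) / level v)) //=.
  by rewrite divfK // subrr mul0r mulr0 subr0 => /eqP.
by apply: Hv; rewrite jr.
Qed.

(** The point of the affine chart [level = 1] with given coordinates. *)
Definition chart (a : 'I_n -> k) (i : 'I_n.+1) : k :=
  if unlift ord0 i is Some j then a j else 1 - \sum_j c j * a j.

Lemma chart_var a j : chart a (var j) = a j.
Proof. by rewrite /chart liftK. Qed.

Lemma level_chart a : level (chart a) = 1.
Proof.
rewrite /level {1}/chart unlift_none.
by under [X in _ - _ + X]eq_bigr => j _ do rewrite chart_var; rewrite subrK.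
Qed.

Lemma chartK v : level v != 0 ->
  v =1 fun i => level v * chart (fun j => v (var j) / level v) i.
Proof.
move=> nz_v i; rewrite /chart; case: unliftP => [j ->|->]; first by rewrite mulrC divfK.
rewrite mulrBr mulr1 mulr_sumr.
under eq_bigr => j _ do rewrite mulrCA [level v * _]mulrC divfK //.
by rewrite /level addrK.
Qed.

Lemma cylinder_ideal_grid t p : homog_of t p ->
  (cylinder_ideal n p <-> forall a, (forall j, a j \in A) -> p.@[chart a] = 0).
Proof.
move=> hp; split=> [Jp a aA|p0 v [nz_v Hv]].
  by apply: Jp; split=> [|j _]; rewrite level_chart ?oner_eq0 // divr1 chart_var.
rewrite (meval_eq _ (chartK nz_v)); case: t hp => [d|d] /= hp; last by rewrite hp meval0.
by rewrite (mevalZ_homog _ _ hp) p0 ?mulr0 // => j; apply: Hv.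
Qed.

End Cylinders.

(** * Duality on a grid *)

Section Nodes.
Variables (k : fieldType) (A : seq k).
Hypothesis A_uniq : uniq A.
Notation s := (size A).
Implicit Types i : 'I_s.

Lemma node_eq i i' : (A`_i == A`_i') = (i == i').
Proof. by rewrite nth_uniq. Qed.

Definition node_poly i : {poly k} := \prod_(i' : 'I_s | i' != i) ('X - (A`_i')%:P).
Definition node_weight i : k := \prod_(i' : 'I_s | i' != i) (A`_i - A`_i').

Lemma node_weight_neq0 i : node_weight i != 0.
Proof.
by apply/prodf_neq0 => i' ne_i; rewrite subr_eq0 node_eq eq_sym.
Qed.

Lemma horner_node_poly i i' :
  (node_poly i).[A`_i'] = if i' == i then node_weight i else 0.
Proof.
rewrite /node_poly horner_prod; case: eqVneq => [->|ne_i].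
  by apply: eq_bigr => j _; rewrite hornerXsubC.
by rewrite (bigD1 i') //= hornerXsubC subrr mul0r.
Qed.

Lemma size_node_poly i : size (node_poly i) = s.
Proof.
rewrite /node_poly -big_filter size_prod_XsubC size_filter -sum1_count.
rewrite sum1_card cardC1 card_ord prednK //.
by case: i => i /=; case: (s).
Qed.

Lemma coef_node_poly i : (node_poly i)`_s.-1 = 1.
Proof.
have : node_poly i \is monic by rewrite /node_poly -big_filter monic_prod_XsubC.
by rewrite monicE /lead_coef size_node_poly => /eqP.
Qed.

(** The sum is the coefficient of [X ^ (s - 1)] in the Lagrange interpolation of
    [X ^ e] at the [s] nodes, which is [X ^ e] itself. *)
Lemma node_sum_eq0 e : (e.+1 < s)%N -> \sum_(i : 'I_s) A`_i ^+ e / node_weight i = 0.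
Proof.
move=> es; pose q := 'X^e - \sum_(i : 'I_s) (A`_i ^+ e / node_weight i) *: node_poly i.
have qs : (size q <= s)%N.
  rewrite (leq_trans (size_polyD _ _)) // geq_max size_polyN size_polyXn (ltnW es) /=.
  apply: (leq_trans (size_sum _ _ _)); apply/bigmax_leqP => i _.
  by rewrite (leq_trans (size_scale_leq _ _)) // size_node_poly.
have q0 : q = 0.
  apply/eqP/negPn/negP => nz_q; suff /(max_poly_roots nz_q) : all (root q) A.
    by move=> /(_ A_uniq); rewrite ltnNge qs.
  apply/(all_nthP 0) => j js; rewrite /root /q hornerD hornerN hornerXn horner_sum.
  rewrite (bigD1 (Ordinal js)) //= big1 => [|i].
    by rewrite hornerZ (horner_node_poly _ (Ordinal js)) eqxx divfK
               ?node_weight_neq0 // addr0 subrr.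
  rewrite eq_sym => /negPf ne; rewrite hornerZ.
  by rewrite (horner_node_poly _ (Ordinal js)) ne mulr0.
have := congr1 (fun r : {poly k} => r`_s.-1) q0.
rewrite coefB coefXn coef_sum coef0 (_ : (_ == _) = false); last by lia.
rewrite sub0r => /eqP; rewrite oppr_eq0 => /eqP e0; rewrite -[RHS]e0.
by apply: eq_bigr => i _; rewrite coefZ coef_node_poly mulr1.
Qed.

Definition all_nodes_poly : {poly k} := \prod_(i : 'I_s) ('X - (A`_i)%:P).

(** The coefficients, as polynomials in [a], of the Bezoutian
    [(G(X) - G(a)) / (X - a)], where [G] is the polynomial of all nodes. *)
Definition bezout_coef (m : nat) (a : k) : k :=
  \sum_(l < s.+1 | (m < l)%N) all_nodes_poly`_l * a ^+ (l.-1 - m).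

Lemma bezoutian i : node_poly i = \sum_(m < s) bezout_coef m A`_i *: 'X^m.
Proof.
pose x := A`_i; have nzX : 'X - x%:P != 0 by rewrite polyXsubC_eq0.
apply: (mulfI nzX).
have EG : ('X - x%:P) * node_poly i = all_nodes_poly.
  by rewrite /all_nodes_poly (bigD1 i).
have Gs : (size all_nodes_poly <= s.+1)%N.
  by rewrite /all_nodes_poly -big_enum size_prod_XsubC size_enum_ord.
have Gx : all_nodes_poly.[x] = 0 by rewrite -EG hornerM hornerXsubC subrr mul0r.
rewrite EG.
have GE : all_nodes_poly = \sum_(l < s.+1) all_nodes_poly`_l *: 'X^l.
  rewrite -poly_def; apply/polyP=> l; rewrite coef_poly; case: ltnP => // lt_l.
  by rewrite nth_default // (leq_trans Gs).
have -> : all_nodes_poly = \sum_(l < s.+1) all_nodes_poly`_l *: ('X^l - (x ^+ l)%:P).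
  transitivity (all_nodes_poly - (all_nodes_poly.[x])%:P); first by rewrite Gx subr0.
  rewrite (horner_coef_wide _ Gs) {1}GE rmorph_sum -sumrB.
  by apply: eq_bigr => l _; rewrite scalerBr /= polyCM mul_polyC.
have step (l : 'I_s.+1) :
    'X^l - (x ^+ l)%:P = ('X - x%:P) * \sum_(m < s | (m < l)%N) x ^+ (l.-1 - m) *: 'X^m.
  rewrite -opprB rmorphXn /= subrXX -mulNr opprB.
  rewrite (big_ord_widen s (fun m => x%:P ^+ (l.-1 - m) * 'X ^+ m)) -1?ltnS //.
  congr (_ * _); apply: eq_bigr => m _.
  by rewrite -mul_polyC rmorphXn.
under eq_bigr => l _ do rewrite step scalerAr big_mkcond scaler_sumr.
rewrite -mulr_sumr exchange_big; congr (_ * _); apply: eq_bigr => m _ /=.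
rewrite /bezout_coef scaler_suml [RHS]big_mkcond; apply: eq_bigr => l _.
by case: ifP => _; rewrite ?scaler0 // scalerA.
Qed.

Lemma bezoutian_node i i' :
  \sum_(m < s) A`_i' ^+ m * bezout_coef m A`_i = if i' == i then node_weight i else 0.
Proof.
rewrite -horner_node_poly bezoutian horner_sum.
by apply: eq_bigr => m _; rewrite hornerZ hornerXn mulrC.
Qed.

End Nodes.

Section DegreeBounds.
Variable k : fieldType.

Lemma msizeM_bound m (p q : {mpoly k[m]}) d e :
  (msize p <= d.+1)%N -> (msize q <= e.+1)%N -> (msize (p * q) <= (d + e).+1)%N.
Proof.
have [->|nz_p] := eqVneq p 0; first by rewrite mul0r msize0.
have [->|nz_q] := eqVneq q 0; first by rewrite mulr0 msize0.
by rewrite msizeM //; move: (msize p) (msize q) => a b; lia.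
Qed.

Lemma msize_prod_bound m (T : Type) (r : seq T) (E : T -> {mpoly k[m]}) (d : T -> nat) :
  (forall i, msize (E i) <= (d i).+1)%N ->
  (msize (\prod_(i <- r) E i) <= (\sum_(i <- r) d i).+1)%N.
Proof.
move=> HE; elim/big_rec2: _ => [|i e p _]; first by rewrite msize1.
exact: msizeM_bound.
Qed.

Lemma msize_exp_bound m (p : {mpoly k[m]}) e :
  (msize p <= 2)%N -> (msize (p ^+ e) <= e.+1)%N.
Proof.
move=> Hp; elim: e => [|e IHe]; first by rewrite expr0 msize1.
by rewrite exprS; apply: (@msizeM_bound _ _ _ 1 e).
Qed.

Lemma msize_sum_bound m N (T : Type) (r : seq T) (P : pred T) (E : T -> {mpoly k[m]}) :
  (forall i, P i -> msize (E i) <= N)%N -> (msize (\sum_(i <- r | P i) E i) <= N)%N.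
Proof.
move=> HE; apply: (big_ind (fun p => msize p <= N)%N) => //; first by rewrite msize0.
by move=> p q Hp Hq; rewrite (leq_trans (msizeD_le _ _)) // geq_max Hp.
Qed.

End DegreeBounds.

Section Grid.
Variables (k : fieldType) (n : nat) (c : 'I_n -> k) (A : seq k).
Notation S := {mpoly k[n.+1]}.
Notation var j := (lift ord0 j : 'I_n.+1).
Notation s := (size A).
Notation grid := {ffun 'I_n -> 'I_s}.
Hypothesis A_uniq : uniq A.
Hypothesis s_gt0 : (0 < s)%N.

Definition grid_point (Q : grid) : 'I_n.+1 -> k := chart c (fun j => A`_(Q j)).
(** The value at [Q] of the Jacobian of the equations of the grid. *)
Definition grid_weight (Q : grid) : k := \prod_j node_weight (Q j).

(** The degree of the socle of the Artinian reduction of the grid. *)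
Definition socle_degree : nat := n * s.-1.

Lemma grid_weight_neq0 Q : grid_weight Q != 0.
Proof. by apply/prodf_neq0 => j _; apply: node_weight_neq0. Qed.

(** Substituting the affine coordinates does not raise the degree, although the
    first variable becomes an inhomogeneous linear polynomial. *)
Lemma dehomogenize d (p : S) : p \is d.-homog ->
  exists2 g : {mpoly k[n]}, (msize g <= d.+1)%N & forall a, p.@[chart c a] = g.@[a].
Proof.
move=> /dhomogP hp.
pose lq (i : 'I_n.+1) : {mpoly k[n]} :=
  if unlift ord0 i is Some j then 'X_j else 1 - \sum_j c j *: 'X_j.
exists (\sum_(m <- msupp p) p@_m *: \prod_i lq i ^+ m i) => [|a].
  rewrite big_seq; apply: msize_sum_bound => m mp.
  rewrite (leq_trans (msizeZ_le _ _)) //; have <- : mdeg m = d := hp m mp.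
  rewrite mdegE; apply: msize_prod_bound => i; apply: msize_exp_bound.
  rewrite /lq; case: (unlift _ _) => [j|]; first by rewrite msizeX mdeg1.
  rewrite (leq_trans (msizeD_le _ _)) // msizeN geq_max msize1 /=.
  apply: msize_sum_bound => j _.
  by rewrite (leq_trans (msizeZ_le _ _)) // msizeX mdeg1.
rewrite mevalE raddf_sum; apply: eq_bigr => m _ /=.
rewrite mevalZ rmorph_prod; congr (_ * _); apply: eq_bigr => i _ /=.
rewrite rmorphXn; congr (_ ^+ _); rewrite /= /chart /lq.
case: (unlift _ _) => [j|] /=; first by rewrite mevalXU.
rewrite mevalB meval1 (raddf_sum (meval a)); congr (_ - _); apply: eq_bigr => j _ /=.
by rewrite mevalZ mevalXU.
Qed.

(** The residue theorem on the grid: in every monomial of degree below the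
    socle degree some exponent is too small for the one-variable sum. *)
Lemma grid_residue p : homog_of (socle_degree%:Z - 1) p ->
  \sum_(Q : grid) p.@[grid_point Q] / grid_weight Q = 0.
Proof.
case: (posnP socle_degree) => [->|D_gt0].
  by move=> /= ->; rewrite big1 // => Q _; rewrite meval0 mul0r.
rewrite (_ : _ - 1 = Posz socle_degree.-1) => [/dehomogenize[g gD pg]|]; last by lia.
rewrite (prednK D_gt0) in gD.
under eq_bigr => Q _ do rewrite pg mevalE mulr_suml.
rewrite exchange_big big1_seq //= => m mg.
under eq_bigr => Q _ do rewrite -mulrA -[_ / grid_weight Q]prodf_div.
rewrite -mulr_sumr -(bigA_distr_bigA (fun j (i : 'I_s) => A`_i ^+ m j / node_weight i)).
have [j mj] : exists j, ((m j).+1 < s)%N.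
  apply: NNPP => H; have := leq_trans (msize_mdeg_lt mg) gD.
  rewrite mdegE ltnNge => /negP; apply.
  rewrite /socle_degree -[n in (n * _)%N]card_ord -sum_nat_const.
  apply: leq_sum => j _; case: leqP => // mj; case: H; exists j.
  by rewrite -(prednK s_gt0) ltnS.
by rewrite (bigD1 j) //= node_sum_eq0 // mul0r mulr0.
Qed.

Lemma grid_vanish_at (P : grid) p : homog_of (socle_degree%:Z - 1) p ->
  (forall Q, Q != P -> p.@[grid_point Q] = 0) -> p.@[grid_point P] = 0.
Proof.
move=> hp p0; have := grid_residue hp; rewrite (bigD1 P) //= big1 => [|Q /p0->].
  rewrite addr0 => /eqP; rewrite mulf_eq0 invr_eq0 (negPf (grid_weight_neq0 _)) orbF.
  by move/eqP.
by rewrite mul0r.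
Qed.

(** The converse of the residue theorem.  The interpolating form of degree
    [socle_degree] given by the Bezoutian is divisible by the [e]-th power of
    the level form, because the coefficients of the remaining monomials
    are pairings of [W] with forms of degree [e - 1]. *)
Lemma grid_interpolation (W : grid -> k) (e : nat) :
  (forall g : S, homog_of (e%:Z - 1) g -> \sum_Q W Q * g.@[grid_point Q] = 0) ->
  exists2 q : S, homog_of (socle_degree%:Z - e%:Z) q
    & forall Q, q.@[grid_point Q] = W Q * grid_weight Q.
Proof.
move=> HW; pose wt (al : grid) := (\sum_j al j)%N.
pose C (al : grid) := \sum_Q W Q * \prod_j bezout_coef A (al j) A`_(Q j).
have wtD al : (wt al <= socle_degree)%N.
  rewrite /socle_degree -[n in (n * _)%N]card_ord -sum_nat_const.
  by apply: leq_sum => j _; rewrite -ltnS prednK.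
pose L : S := level_form c.
have hL i : homog_of i%:Z (L ^+ i).
  rewrite -[i%:Z]natz; exact: (homog_of_exp i (homog_level_form c)).
have hX i (j : 'I_n.+1) : homog_of i%:Z ('X_j ^+ i : S).
  rewrite -[i%:Z]natz; exact: (homog_of_exp i (homog_ofX k j)).
have L1 i Q : (L ^+ i).@[grid_point Q] = 1.
  by rewrite rmorphXn /= meval_level_form level_chart expr1n.
have XQ j Q : ('X_(var j) : S).@[grid_point Q] = A`_(Q j).
  by rewrite mevalXU /grid_point chart_var.
have C0 al : (socle_degree < wt al + e)%N -> C al = 0.
  move=> De; pose g : S := L ^+ (wt al + e - socle_degree.+1) *
    \prod_j \sum_(l < s.+1 | (al j < l)%N) (all_nodes_poly A)`_l *:
       ('X_(var j) ^+ (l.-1 - al j) * L ^+ (s - l)).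
  have <- := HW g; last first.
    rewrite (_ : e%:Z - 1 = (wt al + e - socle_degree.+1)%N%:Z +
               \sum_(j < n) (s.-1 - al j)%N%:Z).
      apply: homog_ofM => //; apply: homog_of_prod => j _.
      apply: homog_of_sum => l lt_l; apply: homog_ofZ.
      have -> : (s.-1 - al j)%N%:Z = (l.-1 - al j)%N%:Z + (s - l)%N%:Z.
        by have := ltn_ord l; lia.
      exact: homog_ofM.
    have : (\sum_(j < n) (s.-1 - al j) + wt al = socle_degree)%N.
      rewrite /socle_degree -[n in (n * _)%N]card_ord -sum_nat_const -big_split /=.
      by apply: eq_bigr => j _; rewrite subnK // -ltnS prednK.
    rewrite -(big_morph Posz PoszD (erefl _)).
    move: De (wtD al); move: (wt al) (\sum_(j < n) _)%N socle_degree => x y z; lia.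
  apply: eq_bigr => Q _; congr (_ * _); rewrite mevalM L1 mul1r rmorph_prod.
  apply: eq_bigr => j _ /=; rewrite raddf_sum; apply: eq_bigr => l _ /=.
  by rewrite mevalZ mevalM L1 mulr1 rmorphXn /= XQ.
exists (\sum_(al | (wt al + e <= socle_degree)%N)
   C al *: (L ^+ (socle_degree - e - wt al) * \prod_j 'X_(var j) ^+ al j)).
  apply: homog_of_sum => al al_e; apply: homog_ofZ.
  have -> : socle_degree%:Z - e%:Z =
      (socle_degree - e - wt al)%N%:Z + \sum_j (al j : nat)%:Z.
    by rewrite -(big_morph Posz PoszD (erefl _)) -/(wt al); lia.
  by apply: homog_ofM => //; apply: homog_of_prod => j _.
move=> P; rewrite raddf_sum big_mkcond /=.
transitivity (\sum_al C al * \prod_j A`_(P j) ^+ al j).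
  apply: eq_bigr => al _; case: leqP => [_|/C0->]; last by rewrite mul0r.
  rewrite mevalZ mevalM L1 mul1r rmorph_prod; congr (_ * _).
  by apply: eq_bigr => j _ /=; rewrite rmorphXn /= XQ.
under eq_bigr => al _ do rewrite mulr_suml.
rewrite exchange_big /= (bigD1 P) //= [X in _ + X]big1 ?addr0 => [|Q neQ].
  under eq_bigr => al _ do rewrite -mulrA -big_split /=.
  rewrite -mulr_sumr; congr (_ * _).
  rewrite -(bigA_distr_bigA (fun j (i : 'I_s) => bezout_coef A i A`_(P j) * A`_(P j) ^+ i)).
  apply: eq_bigr => j _; under eq_bigr => i _ do rewrite mulrC.
  by rewrite bezoutian_node // eqxx.
under eq_bigr => al _ do rewrite -mulrA -big_split /=.
rewrite -mulr_sumr.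
rewrite -(bigA_distr_bigA (fun j (i : 'I_s) => bezout_coef A i A`_(Q j) * A`_(P j) ^+ i)).
have [j neqj] : exists j, Q j != P j.
  by apply/existsP; apply: contraNT neQ => /existsPn H; apply/eqP/ffunP=> j; apply/eqP/negPn.
rewrite (bigD1 j) //=; under eq_bigr => i _ do rewrite mulrC.
by rewrite bezoutian_node // eq_sym (negPf neqj) mul0r mulr0.
Qed.

End Grid.

(** * Subspaces of a coordinate space *)

Section Subspaces.
Variables (k : fieldType) (e : nat) (V : 'rV[k]_e -> Prop).
Hypothesis V0 : V 0.
Hypothesis V_lin : forall t u v, V u -> V v -> V (u + t *: v).

(** A matrix with rows in [V] is enlarged while some vector of [V] is missing; its
    rank bounds the number of steps. *)
Lemma subspace_matrix : exists M : 'M[k]_e, forall u, V u <-> (u <= M)%MS.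
Proof.
suff H d (M : 'M[k]_e) : (e - \rank M <= d)%N -> (forall u, (u <= M)%MS -> V u) ->
    exists M' : 'M[k]_e, forall u, V u <-> (u <= M')%MS.
  apply: (H e 0); first exact: leq_subr.
  by move=> u; rewrite submx0 => /eqP->.
elim: d M => [|d IHd] M rM VM.
  exists M => u; split=> [_|]; last exact: VM.
  by apply: submx_full; rewrite /row_full eqn_leq rank_leq_col /=; lia.
have [H|] := classic (forall u, V u -> (u <= M)%MS).
  by exists M => u; split; [apply: H | apply: VM].
move=> H; have [u uH] := not_all_ex_not _ _ H; have [Vu uM] := imply_to_and _ _ uH.
apply: (IHd (M + u)%MS).
  have : (\rank M < \rank (M + u)%MS)%N.
    rewrite ltn_neqAle mxrankS ?addsmxSl // andbT; apply: contra_notN uM => /eqP r.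
    by rewrite (submx_trans (addsmxSr M u)) // -(geq_leqif (mxrank_leqif_sup (addsmxSl M u))) r.
  have := rank_leq_col (M + u)%MS; lia.
move=> v /sub_addsmxP[[w1 w2] /= ->].
rewrite [w2]mx11_scalar mul_scalar_mx.
by apply: V_lin => //; apply: VM; apply: submxMl.
Qed.

Lemma coordinate_dichotomy (j : 'I_e) :
  V (delta_mx 0 j) \/
  exists2 W : 'I_e -> k, W j != 0 & forall u, V u -> \sum_l W l * u 0 l = 0.
Proof.
have [M HM] := subspace_matrix.
have [/HM|] := boolP ((delta_mx 0 j : 'rV[k]_e) <= M)%MS; first by left.
rewrite submxE -rowE => /rV0Pn[l]; rewrite mxE => Wj; right.
exists (fun l' => cokermx M l' l); first exact: Wj.
move=> u /HM; rewrite submxE => /eqP uM.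
have := congr1 (fun v : 'rV_e => v 0 l) uM.
rewrite [RHS]mxE [LHS]mxE => uMl; rewrite -[RHS]uMl.
by apply: eq_bigr => l' _; rewrite mulrC.
Qed.

End Subspaces.

(** * Points and their normalized coordinates *)

Section Points.
Variables (k : fieldType) (k_infinite : infinite_field k) (n : nat).
Notation S := {mpoly k[n.+1]}.
Notation var j := (lift ord0 j : 'I_n.+1).
Implicit Types (P Q : ppoint k n) (X Z : {fset ppoint k n}).

Definition generator P : 'rV[k]_n.+1 := vpick (val P).

Lemma generator_line P v : v \in val P -> exists t, v = t *: generator P.
Proof.
move=> vP; apply/vlineP; suff -> : <[generator P]>%VS = val P by [].
apply/eqP; rewrite eqEdim -memvE memv_pick (eqP (valP P)) dim_vline.
by rewrite /generator vpick0 -dimv_eq0 (eqP (valP P)).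
Qed.

Lemma generator_neq0 P : generator P != 0.
Proof. by rewrite vpick0 -dimv_eq0 (eqP (valP P)). Qed.

(** The generators are forms, but a polynomial vanishing on lines through the
    origin is the sum of components that vanish there as well. *)
Lemma vanishing_idealP X p :
  vanishing_ideal X p <-> forall P, P \in X -> vanishes_at p P.
Proof.
split=> [Ip P PX v vP|Xp].
  pose J (q : S) := q.@[fun i => v 0 i] = 0.
  apply: (Ip J) => [|q [_ Hq]]; last exact: Hq vP.
  split=> [|x y|c x]; rewrite /J; first exact: meval0.
    by rewrite mevalD => -> ->; rewrite addr0.
  by rewrite mevalM => ->; rewrite mulr0.
move=> J J_ideal GJ; rewrite (hcomp_partition (leqnn (msize p))).
apply: is_ideal_sum => // e _; apply: GJ; split.
  by exists e; apply: (homog_of_hcomp e%:Z p).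
move=> P PX v vP; apply: hcomp_vanish => // t _.
by rewrite -[RHS](Xp P PX (t *: v)) ?memvZ //; apply: meval_eq => i; rewrite mxE.
Qed.

Lemma vanishing_ideal_ideal X : is_ideal (vanishing_ideal X).
Proof.
split=> [J HJ _|x y Ix Iy J HJ GJ|c x Ix J HJ GJ]; first exact: is_ideal0.
  by apply: is_idealD => //; [apply: Ix | apply: Iy].
by apply: is_idealMl => //; apply: Ix.
Qed.

Lemma vanishing_ideal_graded X t p : vanishing_ideal X p -> vanishing_ideal X (hcomp t p).
Proof.
move=> /vanishing_idealP Ip; apply/vanishing_idealP=> P PX v vP.
apply: hcomp_vanish => // x _.
by rewrite -[RHS](Ip P PX (x *: v)) ?memvZ //; apply: meval_eq => i; rewrite mxE.
Qed.

(** The coefficient of the first variable is avoided together with the values at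
    the points, so that a general linear form can be made monic in it. *)
Lemma exists_level X : exists c : 'I_n -> k,
  forall P, P \in X -> level c (fun i => generator P 0 i) != 0.
Proof.
pose phi (u g : 'rV[k]_n.+1) := \sum_i g 0 i * u 0 i.
pose us := delta_mx 0 ord0 :: [seq generator P | P <- enum_fset X].
have [||||g _ Hg] := @avoid_hyperplanes k k_infinite _ (fun _ => True) _ phi us.
- move=> u t v w; rewrite /phi mulr_sumr -big_split.
  by apply: eq_bigr => i _; rewrite !mxE mulrDl mulrA.
- by [].
- by exists 0.
- move=> u uus; have : u != 0.
    move: uus; rewrite inE => /predU1P[->|/mapP[P _ ->]]; last exact: generator_neq0.
    by apply/rV0Pn; exists ord0; rewrite mxE !eqxx oner_eq0.
  case/rV0Pn=> i ui; exists (delta_mx 0 i) => //.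
  rewrite /phi (bigD1 i) //= big1 => [|j /negPf ne]; rewrite !mxE ?eqxx ?ne /=.
    by rewrite addr0 mul1r.
  by rewrite mul0r.
have g0 : g 0 ord0 != 0.
  have := Hg _ (mem_head _ _); rewrite /phi big_ord_recl big1 => [|i _].
    by rewrite !mxE eqxx mulr1 addr0.
  by rewrite !mxE mulr0.
exists (fun j => g 0 (var j) / g 0 ord0) => P PX.
have : phi (generator P) g != 0.
  by apply: Hg; rewrite inE map_f ?orbT.
apply: contraNneq => lev0; rewrite /phi big_ord_recl.
move: (congr1 (fun x => g 0 ord0 * x) lev0); rewrite mulr0 /level mulrDr mulr_sumr => E.
apply/eqP; rewrite -[RHS]E; congr (_ + _); apply: eq_bigr => j _.
by rewrite mulrA [g 0 ord0 * _]mulrC divfK.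
Qed.

Variable c : 'I_n -> k.

(** The representative of a point in the affine chart [level c = 1]. *)
Definition coords P (i : 'I_n.+1) : k :=
  (level c (fun i => generator P 0 i))^-1 * generator P 0 i.

Definition off_infinity X :=
  forall P, P \in X -> level c (fun i => generator P 0 i) != 0.

Section OffInfinity.
Variables (X : {fset ppoint k n}) (X_off : off_infinity X).

Lemma level_coords P : P \in X -> level c (coords P) = 1.
Proof.
move=> /X_off nzP.
by rewrite /coords levelZ mulVf.
Qed.

Lemma coords_line P v : P \in X -> v \in val P ->
  exists t, (fun i => v 0 i) =1 fun i => t * coords P i.
Proof.
move=> /X_off nzP /generator_line[t ->].
exists (t * level c (fun i => generator P 0 i)) => i.
by rewrite mxE /coords mulrA mulfK.
Qed.

Lemma line_coords P t v : (forall i, v i = t * coords P i) ->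
  (\row_i v i) \in val P.
Proof.
move=> Ev; have -> : \row_i v i =
    (t / level c (fun i => generator P 0 i)) *: generator P.
  by apply/rowP=> i; rewrite !mxE Ev /coords mulrA.
by rewrite memvZ // memv_pick.
Qed.

Lemma coords_inj P Q : P \in X -> Q \in X -> coords P =1 coords Q -> P = Q.
Proof.
move=> PX QX ePQ; apply/val_inj/eqP; rewrite eqEdim (eqP (valP P)) (eqP (valP Q)) leqnn andbT.
apply/subvP => v vP; have [t Ht] := coords_line PX vP.
have -> : v = \row_i v 0 i by apply/rowP=> i; rewrite mxE.
by apply: (@line_coords _ t) => i; rewrite -ePQ Ht.
Qed.

Lemma vanishes_at_coords P t p : P \in X -> homog_of t p ->
  p.@[coords P] = 0 -> vanishes_at p P.
Proof.
move=> PX; case: t => [d|d] /= hp p0 v vP; last by rewrite hp meval0.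
have [t Ht] := coords_line PX vP.
by rewrite (meval_eq _ Ht) (mevalZ_homog _ _ hp) p0 mulr0.
Qed.

Lemma coords_vanish P p : vanishes_at p P -> p.@[coords P] = 0.
Proof.
move=> p0; rewrite -(p0 (\row_i coords P i)); first by apply: meval_eq => i; rewrite mxE.
by apply: (@line_coords _ 1) => i; rewrite mul1r.
Qed.

Lemma vanishing_ideal_coords Z t p : {subset Z <= X} -> homog_of t p ->
  vanishing_ideal Z p <-> forall P, P \in Z -> p.@[coords P] = 0.
Proof.
move=> ZX hp; split=> [/vanishing_idealP Ip P PZ|p0].
  exact/coords_vanish/Ip.
by apply/vanishing_idealP => P PZ; apply: (vanishes_at_coords (ZX _ PZ) hp); apply: p0.
Qed.

End OffInfinity.

(** A product of linear forms, one through each of the other points. *)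
Lemma product_separator (T : eqType) (pt : T -> 'I_n.+1 -> k) (r : seq T) v :
  level c v = 1 ->
  (forall w, w \in r -> level c (pt w) = 1 /\ ~ (v =1 pt w)) ->
  exists F : S, [/\ homog_of (size r)%:Z F, F.@[v] != 0
    & forall w, w \in r -> F.@[pt w] = 0].
Proof.
move=> lev_v; elim: r => [|w r IHr] Hr.
  by exists 1; split=> //; [apply: homog_of1 | rewrite meval1 oner_eq0].
have [|F [hF Fv Fr]] := IHr; first by move=> u ur; apply: Hr; rewrite inE ur orbT.
have [lev_w /not_all_ex_not[i /eqP vi]] := Hr w (mem_head _ _).
have E u : ('X_i - pt w i *: level_form c : S).@[u] = u i - pt w i * level c u.
  by rewrite mevalB mevalXU mevalZ meval_level_form.
exists (('X_i - pt w i *: level_form c) * F); split.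
- rewrite (_ : (size _)%:Z = 1 + (size r)%:Z) //; apply: homog_ofM => //.
  apply: homog_ofD; first exact: homog_ofX.
  exact/homog_ofN/homog_ofZ/homog_level_form.
- by rewrite mevalM mulf_neq0 // E lev_v mulr1 subr_eq0.
- move=> u; rewrite inE mevalM E => /predU1P[->|/Fr->]; last by rewrite mulr0.
  by rewrite lev_w mulr1 subrr mul0r.
Qed.

(** A form inducing a multiple of the indicator function of [P] on [Z]. *)
Definition separator Z (t : int) P (F : S) : Prop :=
  [/\ homog_of t F, F.@[coords P] != 0
    & forall Q, Q \in Z -> Q != P -> F.@[coords Q] = 0].

Lemma separator_shift X Z t P F (i : nat) : off_infinity X -> {subset Z <= X} ->
  P \in Z -> separator Z t P F -> separator Z (t + i%:Z) P (F * level_form c ^+ i).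
Proof.
move=> X_off ZX PZ [hF FP FZ]; split.
- apply: homog_ofM => //; rewrite -[i%:Z]natz.
  exact: (homog_of_exp i (homog_level_form c)).
- rewrite mevalM rmorphXn /= meval_level_form (level_coords X_off) ?ZX //.
  by rewrite expr1n mulr1.
- by move=> Q QZ neQ; rewrite mevalM FZ // mul0r.
Qed.

Lemma exists_separator X Z P (i : nat) : off_infinity X -> {subset Z <= X} ->
  P \in Z -> (#|` Z|%fset <= i.+1)%N -> exists F, separator Z i%:Z P F.
Proof.
move=> X_off ZX PZ Zi.
have [||F [hF FP FZ]] := @product_separator _ coords (enum_fset (Z `\ P)%fset) (coords P).
- exact/(level_coords X_off)/ZX.
- move=> Q; rewrite !inE => /andP[neQ QZ].
  split; first exact/(level_coords X_off)/ZX.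
  by move=> e; case/eqP: neQ; apply: (coords_inj X_off); rewrite ?ZX // => j; rewrite e.
have Fsep : separator Z (#|` Z|.-1)%:Z P F.
  split=> //; first by move: hF; rewrite (cardfsD1 P Z) PZ.
  by move=> Q QZ neQ; apply: FZ; rewrite !inE neQ.
exists (F * level_form c ^+ (i - #|` Z|.-1)).
have -> : i%:Z = (#|` Z|.-1)%:Z + (i - #|` Z|.-1)%N%:Z by lia.
exact: (separator_shift _ X_off ZX PZ Fsep).
Qed.

(** Linear duality for the subspace of [k ^ Z] formed by the values of the forms
    of degree [t]. *)
Lemma separator_dichotomy Z t P : P \in Z ->
  (exists F, separator Z t P F) \/
  exists2 W : ppoint k n -> k, W P != 0 &
    forall g, homog_of t g -> \sum_(Q <- enum_fset Z) W Q * g.@[coords Q] = 0.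
Proof.
move=> PZ; pose r := enum_fset Z; pose e := size r.
pose V (u : 'rV[k]_e) := exists2 g : S, homog_of t g &
  forall j, u 0 j = g.@[coords (nth P r j)].
have V0 : V 0.
  by exists 0 => [|j]; [apply: homog_of0 | rewrite mxE meval0].
have VL x u v : V u -> V v -> V (u + x *: v).
  move=> [g hg Hg] [h hh Hh]; exists (g + x *: h).
    by apply: homog_ofD => //; apply: homog_ofZ.
  by move=> j; rewrite !mxE mevalD mevalZ Hg Hh.
have Pe : (index P r < e)%N by rewrite index_mem.
have [[F hF HF]|[W WP HW]] := coordinate_dichotomy V0 VL (Ordinal Pe).
  left; exists F; split=> //.
    have := HF (Ordinal Pe); rewrite mxE !eqxx nth_index // => <-.
    exact: oner_neq0.
  move=> Q QZ neQ; have Qe : (index Q r < e)%N by rewrite index_mem.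
  have ne_ix : Ordinal Qe != Ordinal Pe.
    rewrite -val_eqE /=; apply: contraNneq neQ => eQP.
    by rewrite -(nth_index P QZ) eQP (nth_index P PZ).
  by have := HF (Ordinal Qe); rewrite mxE (negPf ne_ix) andbF nth_index.
right; exists (fun Q => if insub (index Q r) is Some j then W j else 0).
  by rewrite insubT.
move=> g hg; rewrite -[RHS](HW (\row_j g.@[coords (nth P r j)])); last first.
  by exists g => // j; rewrite mxE.
rewrite (big_nth P) big_mkord; apply: eq_bigr => j _; rewrite mxE; congr (_ * _).
rewrite index_uniq ?fset_uniq // insubT //= => je; congr (W _); exact: val_inj.
Qed.

End Points.

(** * The canonical module and separators *)

Section Omega.
Variables (k : fieldType) (k_infinite : infinite_field k) (n : nat).
Notation S := {mpoly k[n.+1]}.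
Notation var j := (lift ord0 j : 'I_n.+1).
Variables (c : 'I_n -> k) (X : {fset ppoint k n}) (X_off : off_infinity c X).
Implicit Types (P : ppoint k n).

(** The same nodes serve for all coordinates; the node 0 makes the grid nonempty
    in every case. *)
Definition nodes : seq k :=
  undup (0 :: [seq coords c P (var j) | P <- enum_fset X, j <- enum 'I_n]).

Notation A := nodes.
Notation s := (size A).
Notation grid := {ffun 'I_n -> 'I_s}.

Lemma nodes_uniq : uniq A. Proof. exact: undup_uniq. Qed.

Lemma nodes_gt0 : (0 < s)%N.
Proof.
have : 0 \in A by rewrite mem_undup mem_head.
by case: A.
Qed.

Lemma coords_node P j : P \in X -> coords c P (var j) \in A.
Proof.
move=> PX; rewrite mem_undup inE; apply/orP; right.
by apply/allpairsP; exists (P, j); rewrite mem_enum.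
Qed.

Definition grid_index (a : 'I_n -> k) : grid :=
  [ffun j => insubd (Ordinal nodes_gt0) (index (a j) A)].

Lemma grid_indexK a j : a j \in A -> A`_(grid_index a j) = a j.
Proof.
move=> aA; rewrite ffunE /insubd insubT ?index_mem //= => ?.
by rewrite nth_index.
Qed.

Definition point_index P : grid := grid_index (fun j => coords c P (var j)).

Lemma chart_eq a a' : a =1 a' -> chart c a =1 chart c a'.
Proof.
move=> e i; rewrite /chart; case: (unlift _ _) => [j|]; first exact: e.
by congr (_ - _); apply: eq_bigr => j _; rewrite e.
Qed.

Lemma coords_grid P : P \in X -> coords c P =1 grid_point c (point_index P).
Proof.
move=> PX i; have lev := level_coords X_off PX.
rewrite (chartK (c := c) (v := coords c P)) lev ?oner_eq0 // mul1r.
apply: chart_eq => j; rewrite divr1 grid_indexK //; exact: coords_node.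
Qed.

Lemma grid_point_inj (Q Q' : grid) : grid_point c Q =1 grid_point c Q' -> Q = Q'.
Proof.
move=> e; apply/ffunP=> j; apply/eqP; rewrite -(node_eq nodes_uniq).
by have := e (var j); rewrite /grid_point !chart_var => ->.
Qed.

Lemma point_index_inj P P' : P \in X -> P' \in X -> point_index P = point_index P' -> P = P'.
Proof.
move=> PX PX' e; apply: (coords_inj X_off) => // i.
by rewrite !coords_grid // e.
Qed.

Lemma meval_coords P (p : S) : P \in X -> p.@[coords c P] = p.@[grid_point c (point_index P)].
Proof. by move=> PX; apply: meval_eq; apply: coords_grid. Qed.

Lemma grid_ideal t (p : S) : homog_of t p ->
  cylinder_ideal c A n p <-> forall Q : grid, p.@[grid_point c Q] = 0.
Proof.
move=> hp; rewrite (cylinder_ideal_grid c A hp); split=> [p0 Q|p0 a aA].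
  by apply: p0 => j; apply: mem_nth.
rewrite -[RHS](p0 (grid_index a)); apply: meval_eq; apply: chart_eq => j.
by rewrite grid_indexK.
Qed.

Section Subset.
Variables (Z : {fset ppoint k n}) (ZX : {subset Z <= X}).
Notation I := (vanishing_ideal Z).
Variable F : gfree_resolution I.

Lemma cylinder_form_in r : (r < n)%N -> I (cylinder_form c A r).
Proof.
move=> rn; apply/(vanishing_ideal_coords k_infinite X_off ZX (homog_cylinder_form c A r)).
move=> P /ZX PX; rewrite /cylinder_form insubT /= meval_grid_form.
rewrite (bigD1_seq (coords c P (var (Sub r rn)))) ?nodes_uniq ?coords_node //=.
by rewrite (level_coords X_off) // mulr1 subrr mul0r.
Qed.

Lemma cylinder_tower :
  regular_tower I n s%:Z (cylinder_ideal c A) (cylinder_form c A).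
Proof.
split.
- exact: cylinder_ideal_ideal.
- by move=> *; apply: cylinder_ideal_graded.
- exact: homog_cylinder_form.
- exact: cylinder_form_in.
- by move=> r p; apply: cylinder_ideal_regular.
- by move=> r p; apply: cylinder_ideal_step; first exact: nodes_uniq.
Qed.

Definition on_Z (Q : grid) := exists2 P, P \in Z & point_index P = Q.

Lemma off_Z_separator Q : ~ on_Z Q -> exists2 y, I y & y.@[grid_point c Q] != 0.
Proof.
move=> offQ; have [||y [hy yQ yZ]] :=
    @product_separator _ _ c _ (coords c) (enum_fset Z) (grid_point c Q).
- exact: level_chart.
- move=> P PZ; split; first exact/(level_coords X_off)/ZX.
  move=> e; apply: offQ; exists P => //; apply: grid_point_inj => i.
  by rewrite e coords_grid ?ZX.
exists y => //; apply/(vanishing_ideal_coords k_infinite X_off ZX hy).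
exact: yZ.
Qed.

(** The ideal of [Z] contains a form that does not vanish at [Q]. *)
Lemma off_Z_vanish t q Q : homog_of t q ->
  (forall y, I y -> cylinder_ideal c A n (q * y)) -> ~ on_Z Q ->
  q.@[grid_point c Q] = 0.
Proof.
move=> hq Iq /off_Z_separator[y Iy yQ].
have : cylinder_ideal c A n (q * y) := Iq y Iy.
move=> /(_ (grid_point c Q)); rewrite mevalM => H.
have /H/eqP: in_cylinder c A n (grid_point c Q).
  split=> [|j _]; rewrite /grid_point level_chart ?oner_eq0 // divr1 chart_var.
  exact: mem_nth.
by rewrite mulf_eq0 (negPf yQ) orbF => /eqP.
Qed.

Lemma coboundary_bdry i (w : 'cV[S]_(rk F i)) :
  coboundary w <-> bdry (cylinder_ideal c A 0) w.
Proof.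
have J0 (p : S) : cylinder_ideal c A 0 p <-> p = 0.
  split=> [|->]; first exact: cylinder_ideal0.
  by apply: is_ideal0; apply: cylinder_ideal_ideal.
have C0 m (v : 'cV[S]_m) : in_col (cylinder_ideal c A 0) v <-> v = 0.
  split=> [H|-> p]; last by apply/J0; rewrite mxE.
  by apply/colP=> p; rewrite mxE; apply/J0.
case: i w => [|i] w /=; first by split=> /C0.
split=> -[u Hu]; exists u; first by apply/C0; rewrite Hu subrr.
by apply/eqP; rewrite -subr_eq0; apply/eqP/C0.
Qed.

Let degE (t : int) : t - n.+1%:Z + s%:Z *+ n = (socle_degree n A)%:Z + t - 1.
Proof.
rewrite /socle_degree -mulr_natr natz; have := nodes_gt0.
case: (s) => // r _ /=; lia.
Qed.

(** A cocycle of degree [t] becomes a form of degree [socle_degree + t - 1],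
    and a separator of degree [- t] multiplies it to degree
    [socle_degree - 1], where the residue theorem applies. *)
Lemma omega_form t (w : 'cV[S]_(rk F n)) : omega_rep t w -> exists q, [/\
    homog_of ((socle_degree n A)%:Z + t - 1) q,
    forall Q, ~ on_Z Q -> q.@[grid_point c Q] = 0,
    forall P G, P \in Z -> homog_of (- t) G ->
      (forall Q, Q \in Z -> Q != P -> G.@[coords c Q] = 0) ->
      cylinder_ideal c A n (G * q)
  & forall g, cylinder_ideal c A n (g * q) -> coboundary (g *: w)].
Proof.
case=> cw hw.
have [||q [hq Iq Bq]] := cocycle_to_form (vanishing_ideal_ideal Z)
    (vanishing_ideal_graded k_infinite (X := Z)) cylinder_tower
    (t := t - n.+1%:Z) (w := w) (addn0 n).
- move=> p; rewrite (cw : diff F n *m w = 0) mxE; exact: is_ideal0 (cylinder_ideal_ideal c A 0).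
- by move=> p; have := hw p; rewrite -addrA.
rewrite degE in hq.
have offZ Q : ~ on_Z Q -> q.@[grid_point c Q] = 0 by apply: off_Z_vanish hq Iq.
exists q; split=> // [P G PZ hG GZ|g /Bq]; last by move/coboundary_bdry.
have hGq : homog_of ((socle_degree n A)%:Z - 1) (G * q).
  have -> : (socle_degree n A)%:Z - 1 = - t + ((socle_degree n A)%:Z + t - 1) by lia.
  exact: homog_ofM.
have Gq0 Q : Q != point_index P -> (G * q).@[grid_point c Q] = 0.
  move=> neQ; rewrite mevalM; have [[P' P'Z eP']|/offZ->] := classic (on_Z Q); last first.
    by rewrite mulr0.
  rewrite -eP' -meval_coords ?ZX // GZ ?mul0r //.
  by apply: contraNneq neQ => <-; rewrite eP' eqxx.
apply/(grid_ideal hGq) => Q; have [->|/Gq0//] := eqVneq Q (point_index P).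
exact: (grid_vanish_at nodes_uniq nodes_gt0 hGq Gq0).
Qed.

(** The product of [G] with the form attached to [w] can be nonzero on the grid
    only at [P], which its degree excludes. *)
Lemma separator_kills t (w : 'cV[S]_(rk F n)) P G :
  omega_rep t w -> P \in Z -> separator c Z (- t) P G ->
  coboundary (G *: w).
Proof.
move=> /omega_form[q [_ _ sepq Bq]] PZ [hG _ GZ]; apply: Bq.
exact: (sepq P).
Qed.

(** The form attached to a cocycle vanishes at every point that has a separator
    of the opposite degree, and it is determined by its values. *)
Lemma omega_zero t : (forall P, P \in Z -> exists G, separator c Z (- t) P G) ->
  ~ omega_nonzero F t.
Proof.
move=> sepZ [w /omega_form[q [hq offZ sepq Bq]] nz_w]; apply: nz_w.
rewrite -(scale1r w); apply: Bq; rewrite mul1r; apply/(grid_ideal hq) => Q.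
have [[P PZ <-]|] := classic (on_Z Q); last exact: offZ.
have [G [hG GP GZ]] := sepZ P PZ.
have := sepq P G PZ hG GZ.
have hGq := homog_ofM hG hq.
move/(grid_ideal hGq)/(_ (point_index P))/eqP.
by rewrite mevalM -(meval_coords G) ?ZX // mulf_eq0 (negPf GP) => /eqP.
Qed.

(** A linear relation between the values on [Z] of the forms of degree [e - 1]
    gives a nonzero element of the canonical module in degree [1 - e]: the
    interpolating form attached to it vanishes on the grid outside [Z], hence
    multiplies the ideal of [Z] into that of the grid. *)
Lemma relation_omega (W : ppoint k n -> k) (e : nat) P0 : P0 \in Z -> W P0 != 0 ->
  (forall g, homog_of (e%:Z - 1) g ->
     \sum_(P <- enum_fset Z) W P * g.@[coords c P] = 0) ->
  omega_nonzero F (1 - e%:Z).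
Proof.
move=> P0Z WP0 HW.
pose W' (Q : grid) := \sum_(P <- enum_fset Z | point_index P == Q) W P.
have [|q hq Hq] := grid_interpolation (c := c) nodes_uniq nodes_gt0 (W := W') (e := e).
  move=> g hg; rewrite -[RHS](HW g hg).
  rewrite (eq_bigr (fun Q => \sum_(P <- enum_fset Z | point_index P == Q)
      W P * g.@[grid_point c Q])); last by move=> Q _; rewrite mulr_suml.
  rewrite (exchange_big_dep predT) //= big_seq [RHS]big_seq; apply: eq_bigr => P PZ.
  rewrite (big_pred1 (point_index P)) ?meval_coords ?ZX // => Q /=; exact: eq_sym.
have Iq y : I y -> cylinder_ideal c A n (q * y).
  move=> /(vanishing_idealP k_infinite) Iy v [nz_v Hv]; rewrite mevalM.
  pose a j := v (var j) / level c v.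
  have Ev : v =1 fun i => level c v * chart c a i := chartK nz_v.
  have {Ev} Ev : v =1 fun i => level c v * grid_point c (grid_index a) i.
    move=> i; rewrite Ev; congr (_ * _); apply: chart_eq => j.
    by rewrite grid_indexK //; apply: Hv.
  have [[P PZ eP]|offZ] := classic (on_Z (grid_index a)).
    have vP : \row_i v i \in val P.
      apply: (@line_coords _ _ c P (level c v)) => i.
      by rewrite coords_grid ?ZX // eP.
    rewrite (_ : y.@[v] = 0) ?mulr0 // -(Iy P PZ _ vP).
    by apply: meval_eq => i; rewrite mxE.
  rewrite (meval_eq q Ev).
  have q0 : q.@[grid_point c (grid_index a)] = 0.
    rewrite Hq /W' big_seq_cond big1 ?mul0r // => P /andP[PZ /eqP eP].
    by case: offZ; exists P.
  case: (_ - _) hq => [d|d] /= hq; last by rewrite hq meval0 mul0r.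
  by rewrite (mevalZ_homog _ _ hq) q0 mulr0 mul0r.
have [||w [cw hw Bw]] := form_to_cocycle F (vanishing_ideal_ideal Z)
    cylinder_tower (t := 1 - e%:Z - n.+1%:Z) (q := q) (addn0 n).
- rewrite degE.
  by have -> : (socle_degree n A)%:Z + (1 - e%:Z) - 1 = (socle_degree n A)%:Z - e%:Z by lia.
- exact: Iq.
exists w; first split.
- apply/colP=> p; rewrite [RHS]mxE; apply: (cylinder_ideal0 k_infinite (c := c) (A := A)).
  exact: cw.
- by move=> p; rewrite -addrA; apply: hw.
move=> /coboundary_bdry /Bw /(grid_ideal hq) /(_ (point_index P0)) /eqP.
rewrite Hq mulf_eq0 (negPf (grid_weight_neq0 nodes_uniq _)) orbF.
rewrite /W' big_mkcond (bigD1_seq P0) ?fset_uniq //= eqxx big1_seq ?addr0 ?(negPf WP0) //.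
move=> P /andP[neP PZ]; case: eqP => // /point_index_inj eP.
by rewrite eP ?ZX ?eqxx in neP.
Qed.

(** The number [a] is the largest degree in which the forms fail to separate the
    points of [Z].  They fail in degree [- 1], where there is no nonzero form,
    and succeed from degree [#|Z| - 1] on by products of linear forms. *)
Lemma a_invariant_bounds a : is_a_invariant F a ->
  [/\ -1 <= a, a + 2 <= (#|` Z|%fset)%:Z
    & forall (i : nat) P, a < i%:Z -> P \in Z -> exists G, separator c Z i%:Z P G].
Proof.
case=> nz_a min_a.
have [P0 P0Z] : exists P, P \in Z.
  apply: NNPP => Z0; apply: (@omega_zero (- a)) => // P PZ.
  by case: Z0; exists P.
have a_ge : -1 <= a.
  have : omega_nonzero F (1 - 0%:Z).
    apply: (relation_omega (W := fun _ => 1) P0Z) => [|g]; first exact: oner_neq0.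
    by move=> /= ->; rewrite big1 // => P _; rewrite meval0 mulr0.
  by move/min_a; lia.
split=> // [|i P ai PZ].
  rewrite leNgt; apply/negP => Za; apply: (@omega_zero (- a)) => // P PZ.
  have Z_gt0 : (0 < #|` Z|)%N by rewrite (cardfsD1 P Z) PZ.
  case: a a_ge Za {nz_a min_a} => [i|i] _ Za; last by lia.
  by rewrite opprK; apply: (exists_separator X_off ZX PZ); lia.
have [//|[W WP HW]] := separator_dichotomy c i%:Z PZ.
have : omega_nonzero F (1 - i.+1%:Z).
  apply: (relation_omega PZ WP) => g.
  by rewrite (_ : i.+1%:Z - 1 = i%:Z); [apply: HW | lia].
by move/min_a; lia.
Qed.

Lemma coboundary_sum i m (v : 'I_m -> 'cV[S]_(rk F i)) :
  (forall j, coboundary (v j)) -> coboundary (\sum_j v j).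
Proof.
case: i v => [|i] v /=; first by move=> v0; rewrite big1.
move=> /fin_all_exists[u Hu]; exists (\sum_j u j).
by rewrite mulmx_sumr; apply: eq_bigr.
Qed.

Lemma coboundaryZ i x (w : 'cV[S]_(rk F i)) : coboundary w -> coboundary (x *: w).
Proof.
case: i w => [|i] w /=; first by move=> ->; rewrite scaler0.
by case=> u ->; exists (x *: u); rewrite scalemxAr.
Qed.

(** Faithfulness forbids separators of degree at most [b], since these kill the
    component of degree [- b]. *)
Lemma b_invariant_relation b (i : nat) P : is_b_invariant F b -> i%:Z <= b -> P \in Z ->
  exists2 W : ppoint k n -> k, W P != 0 &
    forall g, homog_of i%:Z g -> \sum_(Q <- enum_fset Z) W Q * g.@[coords c Q] = 0.
Proof.
case=> faith _ ib PZ; have [[G0 sepG0]|//] := separator_dichotomy c i%:Z PZ.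
have := separator_shift (`|b - i%:Z|)%N X_off ZX PZ sepG0.
rewrite (_ : i%:Z + _ = b); last by lia.
set G := (X in separator _ _ _ _ X) => sepG.
suff /(vanishing_idealP k_infinite)/(_ P PZ)/(coords_vanish c) : I G.
  by case: sepG => _ /eqP.
apply: faith => w [m [x [v [Hv ->]]]]; rewrite scaler_sumr; apply: coboundary_sum => j.
rewrite scalerA mulrC -scalerA; apply: coboundaryZ.
by apply: (separator_kills (Hv j) PZ); rewrite opprK.
Qed.

End Subset.
End Omega.

(** * Order of vanishing at the origin *)

Section Order.
Variables (k : fieldType) (n : nat).
Notation S := {mpoly k[n.+1]}.

Definition ord_ge (r : nat) (p : S) : bool :=
  all (fun mu : 'X_{1..n.+1} => r <= mdeg mu)%N (msupp p).

Lemma ord_geP r p :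
  reflect (forall mu, mu \in msupp p -> (r <= mdeg mu)%N) (ord_ge r p).
Proof. exact: allP. Qed.

Lemma ord_ge0 p : ord_ge 0 p. Proof. exact/ord_geP. Qed.

Lemma ord_ge_zero r : ord_ge r 0.
Proof. by apply/ord_geP => m; rewrite msupp0. Qed.

Lemma ord_geD r p q : ord_ge r p -> ord_ge r q -> ord_ge r (p + q).
Proof.
move=> /ord_geP Hp /ord_geP Hq; apply/ord_geP => m /msuppD_le.
by rewrite mem_cat => /orP[/Hp|/Hq].
Qed.

Lemma ord_geN r p : ord_ge r p -> ord_ge r (- p).
Proof.
by move=> /ord_geP Hp; apply/ord_geP => m; rewrite (perm_mem (msuppN p)) => /Hp.
Qed.

Lemma ord_geM r s p q : ord_ge r p -> ord_ge s q -> ord_ge (r + s) (p * q).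
Proof.
move=> /ord_geP Hp /ord_geP Hq; apply/ord_geP.
move=> m /msuppM_le /allpairsP[[m1 m2] [/Hp m1r /Hq m2s ->]] /=.
by rewrite mdegD leq_add.
Qed.

Lemma ord_geW r s p : (r <= s)%N -> ord_ge s p -> ord_ge r p.
Proof.
by move=> rs /ord_geP Hp; apply/ord_geP => m /Hp; apply: leq_trans.
Qed.

Lemma ord_ge_homog r d (p : S) : homog_of d%:Z p -> (r <= d)%N -> ord_ge r p.
Proof.
by move=> /homog_ofP hp rd; apply/ord_geP => m; rewrite mcoeff_msupp => /hp[->].
Qed.

Lemma ord_ge_sum r (T : Type) (s : seq T) (P : pred T) (E : T -> S) :
  (forall i, P i -> ord_ge r (E i)) -> ord_ge r (\sum_(i <- s | P i) E i).
Proof.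
move=> HE; apply: (big_ind (ord_ge r)) => //; first exact: ord_ge_zero.
by move=> p q; apply: ord_geD.
Qed.

Lemma ord_ge_hcomp0 r t p : t < r%:Z -> ord_ge r p -> hcomp t p = 0.
Proof.
move=> tr /ord_geP Hp; apply/mpolyP=> m; rewrite mcoeff_hcomp mcoeff0; case: eqP => // dm.
by apply/eqP; rewrite mcoeff_eq0; apply/negP => /Hp; lia.
Qed.

Lemma ord_ge_truncate r p : ord_ge r (p - \sum_(e < r) hcomp e%:Z p).
Proof.
apply/ord_geP => m; rewrite mcoeff_msupp mcoeffB (raddf_sum (mcoeff m)) /=.
apply: contraR; rewrite -ltnNge => mr.
under eq_bigr => e _ do rewrite mcoeff_hcomp.
rewrite (bigD1 (Ordinal mr)) //= eqxx big1 ?addr0 ?subrr // => e /negPf ne.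
by case: eqP => // -[em]; move: ne; rewrite -val_eqE /= em eqxx.
Qed.

Lemma ord_ge_lead r p : ord_ge r p -> ord_ge r.+1 (p - hcomp r%:Z p).
Proof.
move=> Hp; have := ord_ge_truncate r.+1 p; rewrite big_ord_recr /= big1 ?add0r // => e _.
by apply: ord_ge_hcomp0 Hp; rewrite ltz_nat.
Qed.

Lemma hcomp_lead r s p q : ord_ge r p -> ord_ge s q ->
  hcomp (r + s)%N%:Z (p * q) = hcomp r%:Z p * hcomp s%:Z q.
Proof.
move=> Hp Hq; have hp := homog_of_hcomp r%:Z p; have hq := homog_of_hcomp s%:Z q.
have Ep : p = (p - hcomp r%:Z p) + hcomp r%:Z p by rewrite subrK.
rewrite {1}Ep mulrDl raddfD /= (ord_ge_hcomp0 _ (ord_geM (ord_ge_lead Hp) Hq)).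
  by rewrite add0r PoszD (hcompM _ _ hp).
by lia.
Qed.

End Order.

Section Core.
Variables (k : fieldType) (k_infinite : infinite_field k) (n : nat).
Notation S := {mpoly k[n.+1]}.
Variables (c : 'I_n -> k) (X : {fset ppoint k n}) (X_off : off_infinity c X).
Implicit Types (P Q : ppoint k n) (Z : {fset ppoint k n}).
Variables (R : comNzRingType) (pi : {rmorphism S -> R}).
Hypothesis R_X : presents_quotient pi (vanishing_ideal X).
Notation m := (hmax_ideal pi).

(** * Powers of the homogeneous maximal ideal *)

Lemma ideal_gen_ideal (A : comNzRingType) (G : A -> Prop) : is_ideal (ideal_gen G).
Proof.
split=> [J HJ _|x y Gx Gy J HJ GJ|a x Gx J HJ GJ]; first exact: is_ideal0.
  by apply: is_idealD => //; [apply: Gx | apply: Gy].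
by apply: is_idealMl => //; apply: Gx.
Qed.

Lemma ideal_exp_ideal (A : comNzRingType) (I : A -> Prop) r : is_ideal (ideal_exp I r).
Proof. by case: r => [|r] //; apply: ideal_gen_ideal. Qed.

Lemma ideal_mulP (A : comNzRingType) (I J : A -> Prop) x y :
  I x -> J y -> ideal_mul I J (x * y).
Proof. by move=> Ix Jy L HL GL; apply: GL; exists x, y. Qed.

Lemma image_ideal (V : S -> Prop) :
  (forall q p, V p -> V (q * p)) -> V 0 -> (forall p q, V p -> V q -> V (p + q)) ->
  is_ideal (fun x => exists2 p, V p & pi p = x).
Proof.
move=> VM V0 VD; split=> [|x y [p Vp <-] [q Vq <-]|x y [p Vp <-]].
- by exists 0; rewrite ?rmorph0.
- by exists (p + q); [apply: VD | rewrite rmorphD].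
- have [q <-] := R_X.1 x.
  by exists (q * p); [apply: VM | rewrite rmorphM].
Qed.

Lemma image_ord_ge_ideal r : is_ideal (fun x => exists2 p, ord_ge r p & pi p = x).
Proof.
apply: image_ideal => [q p Hp||p q]; [|exact: ord_ge_zero|exact: ord_geD].
exact: (ord_geM (ord_ge0 q) Hp).
Qed.

Lemma hmax_ideal_ideal : is_ideal m. Proof. exact: ideal_gen_ideal. Qed.

Lemma hmax_ord_ge x : m x -> exists2 p, ord_ge 1 p & pi p = x.
Proof.
move/(_ _ (image_ord_ge_ideal 1)); apply.
move=> y [i ->]; exists 'X_i => //; exact: ord_ge_homog (homog_ofX k i) _.
Qed.

Lemma hmax_powP r x : ideal_exp m r x <-> exists2 p, ord_ge r p & pi p = x.
Proof.
split.
  elim: r x => [|r IHr] x; first by move=> _; have [p <-] := R_X.1 x; exists p; rewrite ?ord_ge0.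
  move/(_ _ (image_ord_ge_ideal r.+1)); apply.
  move=> y [u [z [/hmax_ord_ge[p Hp <-] /IHr[q Hq <-] ->]]].
  by exists (p * q); [apply: (ord_geM Hp Hq) | rewrite rmorphM].
case=> p Hp <-; rewrite (mpolyE p) rmorph_sum big_seq /=.
apply: (is_ideal_sum (ideal_exp_ideal m r)) => mu /(ord_geP _ _ Hp).
rewrite -mul_mpolyC rmorphM => Hr; apply: (is_idealMl (ideal_exp_ideal m r)).
elim: r mu Hr {Hp} => [|r IHr] mu Hr //.
have [i mui] : exists i, (0 < mu i)%N.
  apply: NNPP => H; move: Hr; rewrite mdegE big1 // => i _.
  by apply/eqP; rewrite -leqn0 leqNgt; apply/negP => Hi; apply: H; exists i.
have Emu : mu = (U_(i) + (mu - U_(i)))%MM.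
  by rewrite addmC submK //; apply/mnm_lepP => j; rewrite mnm1E; case: eqP => // <-.
rewrite Emu mpolyXD rmorphM; apply: ideal_mulP.
  by move=> J HJ GJ; apply: GJ; exists i.
by apply: IHr; move: Hr; rewrite {1}Emu mdegD mdeg1.
Qed.

Lemma pi_eq p q : vanishing_ideal X (p - q) -> pi p = pi q.
Proof. by move/R_X.2; rewrite rmorphB => /eqP; rewrite subr_eq0 => /eqP. Qed.

Lemma ideal_expP (r s : nat) x : (r <= s)%N -> ideal_exp m s x -> ideal_exp m r x.
Proof.
by move=> rs /hmax_powP[p Hp <-]; apply/hmax_powP; exists p; first exact: ord_geW Hp.
Qed.

(** * Interpolation *)

Lemma interpolation Z t (u : ppoint k n -> k) :
  (forall P, P \in Z -> exists G, separator c Z t P G) ->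
  exists2 g, homog_of t g & forall P, P \in Z -> g.@[coords c P] = u P.
Proof.
move=> sepZ.
suff H (r : seq (ppoint k n)) : uniq r -> {subset r <= Z} ->
    exists2 g, homog_of t g & forall P, P \in Z ->
      g.@[coords c P] = if P \in r then u P else 0.
  have [//|g hg Hg] := H (enum_fset Z) (fset_uniq Z).
  by exists g => // P PZ; rewrite Hg // PZ.
elim: r => [|P r IHr] /=.
  by move=> _ _; exists 0 => [|P _]; [apply: homog_of0 | rewrite meval0].
case/andP=> Pr Ur rZ; have PZ : P \in Z by apply: rZ; rewrite mem_head.
have [|g hg Hg] := IHr Ur; first by move=> Q Qr; apply: rZ; rewrite inE Qr orbT.
have [G [hG GP GZ]] := sepZ P PZ.
exists (g + (u P / G.@[coords c P]) *: G).
  by apply: homog_ofD => //; apply: homog_ofZ.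
move=> Q QZ; rewrite mevalD mevalZ Hg // inE.
have [->|neQ] := eqVneq Q P; first by rewrite (negPf Pr) add0r divfK.
by rewrite (GZ Q) // mulr0 addr0.
Qed.

(** The values of the quotient at the points of [Z] are prescribed, and in
    degree [t] every choice of values is attained. *)
Lemma divide_by_linear Z t l g : {subset Z <= X} ->
  (forall P, P \in Z -> exists G, separator c Z t P G) ->
  homog_of 1 l -> (forall P, P \in Z -> l.@[coords c P] != 0) ->
  homog_of (1 + t) g ->
  exists2 g', homog_of t g' & vanishing_ideal Z (g - l * g').
Proof.
move=> ZX sepZ hl lZ hg.
have [g' hg' Hg'] := interpolation (fun P => g.@[coords c P] / l.@[coords c P]) sepZ.
exists g' => //.
have h : homog_of (1 + t) (g - l * g') by apply/homog_ofD/homog_ofN/homog_ofM.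
apply/(vanishing_ideal_coords k_infinite X_off ZX h) => P PZ.
by rewrite mevalB mevalM Hg' // mulrC divfK ?lZ // subrr.
Qed.

(** * Reductions contain high powers *)

(** A reduction contains an element whose linear part vanishes at no point:
    otherwise, at one of the points, the components of degree [r + 1] of all
    elements of [K * m ^ r = m ^ (r + 1)] would vanish. *)
Lemma reduction_general_element K : is_reduction K m ->
  exists y, [/\ K (pi y), ord_ge 1 y
    & forall P, P \in X -> (hcomp 1 y).@[coords c P] != 0].
Proof.
case=> K_ideal Km [r Kr].
pose W (y : S) := K (pi y) /\ ord_ge 1 y.
have [||||y [Ky y1] Hy] := @avoid_hyperplanes k k_infinite S W _
    (fun P y => (hcomp 1 y).@[coords c P]) (enum_fset X).
- by move=> P t u v; rewrite linearD linearZ /= mevalD mevalZ.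
- move=> t u v [Ku u1] [Kv v1]; rewrite /W rmorphD -mul_mpolyC rmorphM.
  split; first by apply: (is_idealD K_ideal) => //; apply: (is_idealMl K_ideal).
  exact/(ord_geD u1)/(ord_geM (ord_ge0 _) v1).
- by exists 0; split; [rewrite rmorph0; apply: is_ideal0 | apply: ord_ge_zero].
- move=> P PX; apply: NNPP => noW.
  have Wvan y : W y -> (hcomp 1 y).@[coords c P] = 0.
    by move=> Wy; apply: NNPP => /eqP H; apply: noW; exists y.
  pose V (p : S) := ord_ge r.+1 p /\ (hcomp r.+1%:Z p).@[coords c P] = 0.
  have Vid : is_ideal (fun x => exists2 p, V p & pi p = x).
    apply: image_ideal => [q p [Hp p0]||p q [Hp p0] [Hq q0]].
    - split; first exact: (ord_geM (ord_ge0 q) Hp).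
      by rewrite -[r.+1]add0n (hcomp_lead (ord_ge0 q) Hp) mevalM p0 mulr0.
    - by split; [apply: ord_ge_zero | rewrite raddf0 meval0].
    - by split; [apply: ord_geD | rewrite raddfD /= mevalD p0 q0 addr0].
  have L0 : ord_ge r.+1 (level_form c ^+ r.+1).
    apply: (@ord_ge_homog _ _ _ r.+1) => //.
    rewrite -[r.+1%:Z]natz; exact: (homog_of_exp r.+1 (homog_level_form c)).
  have : ideal_exp m r.+1 (pi (level_form c ^+ r.+1)).
    by apply/hmax_powP; exists (level_form c ^+ r.+1).
  move/Kr/(_ _ Vid)=> [|p [Hp p0] Ep].
    move=> x [y [z [Ky /hmax_powP[q Hq <-] ->]]].
    have [y' y'1 Ey] := hmax_ord_ge (Km _ Ky).
    exists (y' * q); last by rewrite rmorphM Ey.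
    split; first exact: (ord_geM y'1 Hq).
    rewrite -[r.+1]add1n (hcomp_lead y'1 Hq) mevalM Wvan ?mul0r //.
    by split; rewrite ?Ey.
  have : vanishing_ideal X (level_form c ^+ r.+1 - p).
    by apply/R_X.2; rewrite rmorphB Ep subrr.
  move=> /(vanishing_ideal_graded k_infinite r.+1%:Z)/(vanishing_idealP k_infinite).
  move=> /(_ P PX)/(coords_vanish c); rewrite raddfB /= mevalB p0 subr0 hcomp_id.
    rewrite rmorphXn /= meval_level_form (level_coords X_off) // expr1n.
    by move/eqP; rewrite oner_eq0.
  rewrite -[r.+1%:Z]natz; exact: (homog_of_exp r.+1 (homog_level_form c)).
by exists y; split.
Qed.

(** In degrees where the forms separate the points of [Z], division by the
    linear part of a general element of [K] is possible modulo [I_Z], and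
    multiplication by [f] carries [I_Z] into [I_X].  Each division raises the
    order of the remainder, until it lies in a power of [m] contained in [K]. *)
Lemma reduction_contains K Z (f : S) (d0 : nat) : is_reduction K m -> {subset Z <= X} ->
  (forall y, vanishing_ideal Z y -> vanishing_ideal X (f * y)) ->
  (forall (i : nat) P, (d0 <= i)%N -> P \in Z -> exists G, separator c Z i%:Z P G) ->
  forall p, ord_ge d0.+1 p -> K (pi (f * p)).
Proof.
move=> redK ZX fZ sepZ.
have [y [Ky y1 yX]] := reduction_general_element redK.
have [K_ideal Km [r Kr]] := redK.
have Kpow x : ideal_exp m r.+1 x -> K x.
  move/Kr/(_ K K_ideal); apply=> u [z [v [Kz _ ->]]]; exact: (is_idealMr K_ideal).
suff H N i p : (r.+1 <= i + N)%N -> (d0 < i)%N -> ord_ge i p -> K (pi (f * p)).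
  by move=> p; apply: (H r.+1 d0.+1); rewrite ?leq_addl.
elim: N i p => [|N IHN] i p iN d0i Hp.
  apply/Kpow/hmax_powP; exists (f * p) => //; rewrite addn0 in iN.
  exact: ord_geW iN (ord_geM (ord_ge0 f) Hp).
case: i iN d0i Hp => // i iN d0i Hp; pose g := hcomp i.+1%:Z p.
have [||||g' hg' Ig] := @divide_by_linear Z i%:Z (hcomp 1 y) g ZX.
- by move=> P PZ; apply: sepZ.
- exact: homog_of_hcomp.
- by move=> P /ZX; apply: yX.
- exact: (homog_of_hcomp i.+1%:Z p).
have g'i : ord_ge i g' by exact: ord_ge_homog hg' _.
pose h := y - hcomp 1 y; have h2 : ord_ge 2 h := ord_ge_lead y1.
have -> : f * p = f * (p - g - h * g') + f * (g - hcomp 1 y * g') + y * (f * g').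
  by rewrite /h; ring.
rewrite !rmorphD [pi (f * (g - _))](_ : _ = 0); last by apply/R_X.2; apply: fZ.
rewrite addr0 rmorphM; apply: is_idealD => //; last first.
  by rewrite rmorphM; apply: is_idealMr.
apply: (IHN i.+2); [by rewrite addSnnS | exact: ltnW |].
apply: ord_geD; first exact: ord_ge_lead.
by apply/ord_geN; exact: (ord_geM h2 g'i).
Qed.

(** * Principal reductions *)

Section Principal.
Variables (l : S) (hl : homog_of 1 l).
Hypothesis lX : forall P, P \in X -> l.@[coords c P] != 0.

Let Kl (x : R) : Prop := exists g, x = pi (l * g).

Lemma divide_ord_ge r p : (#|` X|%fset <= r)%N -> ord_ge r.+1 p ->
  exists2 g, ord_ge r g & vanishing_ideal X (p - l * g).
Proof.
move=> Xr Hp.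
have /fin_all_exists2[g Hg Ig] (e : 'I_(msize p)) :
    exists2 g, ord_ge r g & vanishing_ideal X (hcomp e%:Z p - l * g).
  have [er|re] := leqP e r.
    exists 0; first exact: ord_ge_zero.
    rewrite (ord_ge_hcomp0 _ Hp) ?ltz_nat // mulr0 subrr.
    exact: is_ideal0 (vanishing_ideal_ideal X).
  have [|||g hg Ig] := @divide_by_linear X (e.-1)%:Z l (hcomp e%:Z p) _ _ hl lX.
  - by [].
  - move=> P PX; apply: (exists_separator X_off) => //; lia.
  - have -> : 1 + (e.-1)%:Z = e%:Z by lia.
    exact: homog_of_hcomp.
  by exists g => //; apply: (ord_ge_homog hg); lia.
exists (\sum_e g e); first by apply: ord_ge_sum => e _; apply: Hg.
rewrite {1}(hcomp_partition (leqnn (msize p))) mulr_sumr -sumrB.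
by apply: is_ideal_sum; [apply: vanishing_ideal_ideal | move=> e _; apply: Ig].
Qed.

Lemma principal_reduction : is_reduction Kl m.
Proof.
have Kl_ideal : is_ideal Kl.
  split=> [|x y [g ->] [h ->]|x y [g ->]].
  - by exists 0; rewrite mulr0 rmorph0.
  - by exists (g + h); rewrite mulrDr rmorphD.
  - by have [q <-] := R_X.1 x; exists (q * g); rewrite mulrCA [RHS]rmorphM.
split=> //.
  move=> x [g ->].
  suff /hmax_powP : exists2 p, ord_ge 1 p & pi p = pi (l * g).
    move/(_ m hmax_ideal_ideal); apply=> y [u [v [mu _ ->]]].
    exact: (is_idealMr hmax_ideal_ideal).
  exists (l * g) => //; rewrite -[1%N]addn0.
  exact: (ord_geM (ord_ge_homog hl (leqnn 1)) (ord_ge0 g)).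
exists #|` X|%fset => x; split.
  move/hmax_powP=> [p Hp <-]; have [g Hg Ig] := divide_ord_ge (leqnn _) Hp.
  rewrite (pi_eq Ig) rmorphM; apply: ideal_mulP; last by apply/hmax_powP; exists g.
  by exists 1; rewrite mulr1.
move/(_ _ (ideal_exp_ideal m _)); apply.
move=> y [u [z [[g ->] /hmax_powP[q Hq <-] ->]]]; apply/hmax_powP.
exists (l * g * q); last by rewrite rmorphM.
rewrite -mulrA -add1n; apply: (ord_geM (ord_ge_homog hl (leqnn 1))).
exact: (ord_geM (ord_ge0 g) Hq).
Qed.

Lemma core_divisible x : core m x -> exists g, x = pi (l * g).
Proof. by move/(_ _ principal_reduction). Qed.

End Principal.

(** * The core lies in a power of the maximal ideal *)

(** The functions [l |-> 1 / l(P)] on general linear forms [l], for distinct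
    points [P], are linearly independent: along a pencil through a form
    vanishing at [P] only, the term of [P] alone has a pole. *)
Lemma inverse_linear_forms_free (al : ppoint k n -> k) :
  (forall l, homog_of 1 l -> (forall Q, Q \in X -> l.@[coords c Q] != 0) ->
     \sum_(Q <- enum_fset X) al Q / l.@[coords c Q] = 0) ->
  forall P, P \in X -> al P = 0.
Proof.
move=> Hal P PX.
pose W (l : S) := homog_of 1 l /\ l.@[coords c P] = 0.
have [||||l [hl lP] lX] := @avoid_hyperplanes k k_infinite S W _
    (fun Q l => l.@[coords c Q]) (enum_fset (X `\ P)%fset).
- by move=> Q t u v; rewrite mevalD mevalZ.
- move=> t u v [hu uP] [hv vP]; split; first exact/homog_ofD/homog_ofZ.
  by rewrite mevalD mevalZ uP vP mulr0 addr0.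
- by exists 0; split; [apply: homog_of0 | rewrite meval0].
- move=> Q; rewrite !inE => /andP[neQ QX].
  have [||l [hl lQ lP]] := @product_separator k n c _ (coords c) [:: P] (coords c Q).
  + exact: (level_coords X_off).
  + move=> w; rewrite inE => /eqP->; split; first exact: (level_coords X_off).
    by move=> e; case/eqP: neQ; apply: (coords_inj X_off).
  by exists l => //; split=> //; apply: lP; rewrite mem_head.
pose v Q := l.@[coords c Q].
pose q := \sum_(Q <- enum_fset X) al Q *:
  \prod_(Q' <- enum_fset X | Q' != Q) ((v Q')%:P + 'X).
have q0 : q = 0.
  apply: (poly_eq0_cofinite k_infinite (s := [seq - v Q | Q <- enum_fset X])) => t Ht.
  have nz Q : Q \in X -> v Q + t != 0.
    by move=> QX; apply: contraNneq Ht => /eqP; rewrite addrC addr_eq0 => /eqP->; apply: map_f.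
  have lE Q : Q \in X -> (l + t *: level_form c).@[coords c Q] = v Q + t.
    by move=> QX; rewrite mevalD mevalZ meval_level_form (level_coords X_off) // mulr1.
  have := Hal (l + t *: level_form c); rewrite big_seq => H.
  rewrite horner_sum; transitivity
    ((\prod_(Q <- enum_fset X) (v Q + t)) *
      \sum_(Q <- enum_fset X | Q \in X) al Q / (l + t *: level_form c).@[coords c Q]).
    rewrite big_seq mulr_sumr; apply: eq_bigr => Q QX; rewrite lE // hornerZ horner_prod.
    rewrite [in RHS](bigD1_seq Q) ?fset_uniq //=.
    under eq_bigr => Q' _ do rewrite hornerD hornerC hornerX.
    by move: (\prod_(_ <- _ | _) _) (nz Q QX) => z nzQ; field.
  rewrite H ?mulr0 // => [|Q QX]; last by rewrite lE ?nz.
  by apply: homog_ofD => //; apply/homog_ofZ/homog_level_form.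
have := congr1 (fun r : {poly k} => r.[0]) q0; rewrite horner0 horner_sum.
rewrite (bigD1_seq P) ?fset_uniq //= [X in _ + X]big1 => [|Q neQ].
  rewrite addr0 hornerZ => /eqP; rewrite mulf_eq0 => /orP[/eqP//|].
  rewrite horner_prod prodf_seq_eq0 => /hasP[Q QX /andP[neQ]].
  by rewrite hornerD hornerC hornerX addr0 /v (negPf (lX Q _)) // !inE neQ.
apply/eqP; rewrite hornerZ horner_prod mulf_eq0 prodf_seq_eq0; apply/orP; right.
by apply/hasP; exists P; rewrite // eq_sym neQ hornerD hornerC hornerX /v lP addr0 eqxx.
Qed.

(** An element of the core is divisible by every general linear form [l]; in
    degree at most [b + 1] the quotients satisfy the relations provided by
    faithfulness, which read [sum W(Q) x(Q) / l(Q) = 0]. *)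
Lemma core_component_vanish (F : gfree_resolution (vanishing_ideal X)) (b : nat) p
    (e : nat) : is_b_invariant F b%:Z -> core m (pi p) -> (e <= b.+1)%N ->
  vanishing_ideal X (hcomp e%:Z p).
Proof.
move=> bF core_p eb.
have he := homog_of_hcomp e%:Z p.
apply/(vanishing_ideal_coords k_infinite X_off (fun _ => id) he) => P PX.
have [W WP HW] := b_invariant_relation k_infinite X_off (fun _ => id) bF (lexx _) PX.
apply/eqP; have : W P * (hcomp e%:Z p).@[coords c P] = 0.
  apply: (inverse_linear_forms_free (al := fun Q => W Q * _)) PX => l hl lX.
  have [g Eg] := core_divisible hl lX core_p.
  have Ig : vanishing_ideal X (p - l * g) by apply/R_X.2; rewrite rmorphB Eg subrr.
  pose u := hcomp (e%:Z - 1) g.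
  have hu : homog_of (e%:Z - 1) u := homog_of_hcomp _ _.
  have hlu : homog_of e%:Z (l * u).
    by have := homog_ofM hl hu; rewrite addrC subrK.
  have Iu : vanishing_ideal X (hcomp e%:Z p - l * u).
    have := vanishing_ideal_graded k_infinite e%:Z Ig.
    by rewrite raddfB /= (hcompMr _ _ hl).
  move/(vanishing_ideal_coords k_infinite X_off (fun _ => id)
          (homog_ofD he (homog_ofN hlu))) in Iu.
  rewrite -[RHS](HW (u * level_form c ^+ (b.+1 - e))).
    apply: eq_big_seq => Q QX; rewrite mevalM rmorphXn /= meval_level_form.
    rewrite (level_coords X_off) // expr1n mulr1 -mulrA; congr (_ * _).
    have /eqP := Iu Q QX; rewrite mevalB mevalM subr_eq0 => /eqP->.
    by rewrite mulrC mulKf ?lX.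
  have -> : b%:Z = (e%:Z - 1) + (b.+1 - e)%N%:Z by lia.
  apply: homog_ofM => //; rewrite -[(_ - _)%N%:Z]natz.
  exact: (homog_of_exp _ (homog_level_form c)).
by move/eqP; rewrite mulf_eq0 (negPf WP).
Qed.

End Core.

Theorem corollary5p4 (k : fieldType) (k_infinite : infinite_field k) (n : nat)
    (X Y Z : {fset ppoint k n}) (X_eq : X = (Y `|` Z)%fset)
    (f : {mpoly k[n.+1]}) (d : nat) (d_gt0 : (0 < d)%N) (f_neq0 : f != 0)
    (f_homog : f \is d.-homog) (f_Y : forall P, P \in Y -> vanishes_at f P)
    (e : nat) (e_Z : e = #|` Z|%fset)
    (R : comNzRingType) (pi : {rmorphism {mpoly k[n.+1]} -> R})
    (R_X : presents_quotient pi (vanishing_ideal X))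
    (FX : gfree_resolution (vanishing_ideal X))
    (FZ : gfree_resolution (vanishing_ideal Z))
    (a b a' : int) (aX : is_a_invariant FX a) (bX : is_b_invariant FX b)
    (aZ : is_a_invariant FZ a') :
  let m := hmax_ideal pi in
  [/\ subideal
        (ideal_add (ideal_expz m (a + 2))
                   (ideal_scale (pi f) (ideal_expz m e%:Z)))
        (ideal_add (ideal_expz m (a + 2))
                   (ideal_scale (pi f) (ideal_expz m (a' + 2)))),
      subideal
        (ideal_add (ideal_expz m (a + 2))
                   (ideal_scale (pi f) (ideal_expz m (a' + 2))))
        (core m)
    & subideal (core m) (ideal_expz m (b + 2))].
Proof.
move=> m.
have [c X_off] := exists_level k_infinite X.
have ZX : {subset Z <= X} by move=> P PZ; rewrite X_eq inE PZ orbT.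
have XX : {subset X <= X} by [].
have [a_ge _ sepX] := a_invariant_bounds k_infinite X_off XX aX.
have [a'_ge a'_le sepZ] := a_invariant_bounds k_infinite X_off ZX aZ.
have {a_ge sepX aX} [r -> sepX] : exists2 r : nat, a + 2 = r.+1%:Z &
    forall (i : nat) P, (r <= i)%N -> P \in X -> exists G, separator c X i%:Z P G.
  exists (absz (a + 1)); first lia.
  by move=> i P ri; apply: sepX; lia.
have {a'_ge a'_le sepZ aZ} [r' -> [r'e sepZ]] : exists2 r' : nat, a' + 2 = r'.+1%:Z &
    (r' < e)%N /\ forall (i : nat) P, (r' <= i)%N -> P \in Z ->
      exists G, separator c Z i%:Z P G.
  exists (absz (a' + 1)); first lia.
  by split=> [|i P ri]; [lia | apply: sepZ; lia].
split.
- move=> x [y [z [my [w mw ->] ->]]]; exists y, (pi f * w); split=> //.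
  by exists w => //; exact: (ideal_expP R_X r'e mw).
- move=> x [y [z [/(hmax_powP R_X)[p Hp <-] [w /(hmax_powP R_X)[q Hq <-] ->] ->]]].
  move=> K redK; have [K_ideal _ _] := redK.
  apply: (is_idealD K_ideal).
    rewrite -[p]mul1r; apply: (reduction_contains k_infinite X_off R_X redK XX _ sepX Hp).
    by move=> u; rewrite mul1r.
  rewrite -rmorphM.
  apply: (reduction_contains k_infinite X_off R_X redK ZX _ sepZ Hq) => u.
  move=> /(vanishing_idealP k_infinite) Iu; apply/(vanishing_idealP k_infinite).
  move=> P; rewrite X_eq inE => /orP[/f_Y fP|/Iu uP] v vP; rewrite mevalM.
    by rewrite fP // mul0r.
  by rewrite uP // mulr0.
- move=> x core_x.
  have mx : m x.
    apply: core_x; split=> //; first exact: hmax_ideal_ideal.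
    by exists 0.
  have [p p1 Ep] := hmax_ord_ge R_X mx; subst x.
  case: b bX => [b|[|[|b]]] bX //; last by apply/(hmax_powP R_X); exists p.
  rewrite (_ : Posz b + 2 = b.+2%:Z); last by lia.
  apply/(hmax_powP R_X).
  exists (p - \sum_(i < b.+2) hcomp i%:Z p); first exact: ord_ge_truncate.
  apply: (pi_eq R_X); rewrite addrAC subrr add0r.
  have X_ideal := vanishing_ideal_ideal X.
  apply: (is_idealN X_ideal); apply: (is_ideal_sum X_ideal) => i _.
  apply: (core_component_vanish k_infinite X_off R_X bX core_x).
  by rewrite -ltnS.
Qed.
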